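(* Let $G$ be a non-compact compactly generated (locally compact) abelian group, let $(\Phi,\Psi)$ be a complementary pair of continuous strictly increasing Young functions, and let $\omega$ be the weight on $G$ given by $\omega(t)=e^{\nu(|t|)}$ ($t\in G$), where $|\cdot|$ is the length function on $G$ and $\nu:\mathbb{N}\cup\{0\}\to[0,\infty)$ is an increasing subadditive function with $\nu(0)=0$ and $\lim_{n\to\infty}\nu(n)=\infty$. Suppose that $(L^\Phi_\omega(G),* )$ is a Banach algebra and $1/\omega\in L^\Psi(G)$. If $\tilde\Phi(x):=\Phi(\sqrt{x})$ is a Young function, then neither $L^\Phi_\omega(G)$ nor $\mathcal{S}^\Phi_\omega(G)$ is weakly amenable.
   Context: $G$ carries a fixed Haar measure $ds$. Length function: by the structure theorem, $G\cong\mathbb{R}^k\times\mathbb{Z}^m\times T$ with $k,m\in\mathbb{N}\cup\{0\}$ and $T$ a compact abelian group. Fixing this identification, let $U=(-1,1)^k\times\{-1,0,1\}^m\times T$, a generating set of $G$, let $U^n$ be the set of all sums of $n$ elements of $U$, and set $|s|=\inf\{n\in\mathbb{N}:s\in U^n\}$ for $s\ne e$, $|e|=0$. Young functions: a nonzero function $\Phi:[0,\infty)\to[0,\infty]$ is a Young function if it is convex, $\Phi(0)=0$ and $\lim_{x\to\infty}\Phi(x)=\infty$. Its complementary function is $\Psi(y)=\sup\{xy-\Phi(x):x\ge 0\}$ ($y\ge0$), which is again a Young function whose complementary function is $\Phi$; $(\Phi,\Psi)$ is then called a complementary pair. Orlicz spaces: $L^\Phi(G)$ is the space of (classes of) measurable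 $f:G\to\mathbb{C}$ with $\int_G\Phi(\alpha|f(s)|)\,ds<\infty$ for some $\alpha>0$, with norm $\|f\|_\Phi=\sup\{\int_G|f(s)v(s)|\,ds:\int_G\Psi(|v(s)|)\,ds\le1\}$. $\mathcal{S}^\Phi(G)$ is the closure in $L^\Phi(G)$ of the linear space of all step functions in $L^\Phi(G)$. Weights: a weight on $G$ is a locally integrable measurable function $\omega:G\to(0,\infty)$ with $\omega(e)=1$, $1/\omega\in L^\infty(G)$, and such that for some $C>0$, $\omega(st)\le C\omega(s)\omega(t)$ for all $s,t\in G$ (group operation written multiplicatively). Weighted spaces: $L^\Phi_\omega(G)=\{f: f\omega\in L^\Phi(G)\}$ with norm $\|f\|_{\Phi,\omega}=\|f\omega\|_\Phi$, and $\mathcal{S}^\Phi_\omega(G)=\{f:f\omega\in\mathcal{S}^\Phi(G)\}$, a closed subspace. ''$(L^\Phi_\omega(G),* )$ is a Banach algebra'' means that it is a Banach algebra under convolution $*$, where multiplication is only required to be bounded ($\|f*g\|\le K\|f\|\|g\|$ for some constant $K$), not contractive. In that case $\mathcal{S}^\Phi_\omega(G)$ is a closed subalgebra. A Banach algebra $A$ is weakly amenable if every bounded derivation $D:A\to A^*$ is inner. *)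

(* Defs.v *)
From HB Require Import structures.
From mathcomp Require Import all_boot all_order all_algebra.
From mathcomp Require Import complex.
From mathcomp Require Import all_classical all_reals all_analysis.

Set Implicit Arguments.
Unset Strict Implicit.
Unset Printing Implicit Defensive.

Import Order.TTheory GRing.Theory Num.Theory.
Import numFieldNormedType.Exports.
Import Normc.

Local Open Scope classical_set_scope.
Local Open Scope ring_scope.

Definition borel (G : topologicalZmodType) : Type := G.

HB.instance Definition _ (G : topologicalZmodType) :=
  Choice.copy (borel G) G.
HB.instance Definition _ (G : topologicalZmodType) :=
  isPointed.Build (borel G) (0 : G).
HB.instance Definition _ (G : topologicalZmodType) :=
  @isMeasurable.Build (sigma_display (@open G)) (borel G) <<s @open G >>
    (@sigma_algebra0 _ setT (@open G)) (@sigma_algebraC (borel G) (@open G))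
    (@sigma_algebra_bigcup _ setT (@open G)).

Section Groups.
Context {R : realType}.

(* Radon regularity is outer on Borel sets and inner on open sets. *)
Record haar_measure (G : topologicalZmodType)
    (mu : {measure set (borel G) -> \bar R}) : Prop := HaarMeasure {
  haar_neq0 : mu setT <> 0%E;
  haar_compact : forall K : set G, compact K -> (mu K < +oo)%E;
  haar_translation : forall (s : G) (A : set (borel G)),
    measurable A -> mu [set s + t | t in (A : set G)] = mu A;
  haar_outer_regular : forall A : set (borel G), measurable A ->
    mu A = ereal_inf [set mu V | V in [set V : set G | open V /\ A `<=` V]];
  haar_inner_regular : forall V : set G, open V ->
    mu V = ereal_sup [set mu K | K in [set K : set G | compact K /\ K `<=` V]]
}.

Definition sumset (G : zmodType) (U : set G) (n : nat) : set G :=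
  [set s | exists2 u : 'I_n -> G, (forall i, U (u i)) & s = \sum_(i < n) u i].

Definition compactly_generated (G : topologicalZmodType) : Prop :=
  exists2 K : set G, compact K &
    forall s, exists n, sumset (K `|` [set - t | t in K]) n s.

Definition topological_group_iso (G T : topologicalZmodType) (k m : nat)
    (iota : G -> 'rV[R]_k * discrete_topology 'rV[int]_m * T) : Prop :=
  [/\ forall s t, iota (s + t) = iota s + iota t, continuous iota &
      exists2 j, cancel iota j /\ cancel j iota & continuous j].

Definition unit_box (G T : topologicalZmodType) (k m : nat)
    (iota : G -> 'rV[R]_k * discrete_topology 'rV[int]_m * T) : set G :=
  [set s | (forall i, `|(iota s).1.1 0 i| < 1) /\
           (forall j, ((iota s).1.2 : 'rV[int]_m) 0 j \in [:: -1; 0; 1])].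

(* The value is arbitrary (0) at points s != 0 outside every sumset U n;
   there are none when U generates G. *)
Definition word_length (G : zmodType) (U : set G) (s : G) : nat :=
  if s == 0 then 0%N else
  match pselect (exists n, `[< (0 < n)%N /\ sumset U n s >]) with
  | left h => ex_minn h
  | right _ => 0%N
  end.

End Groups.

(* A function [0, +oo[ -> [0, +oo] is represented by a function on R of which
   only the restriction to [0, +oo[ is ever used. *)
Section Young.
Context {R : realType}.
Implicit Types Phi Psi : R -> \bar R.
Local Open Scope ereal_scope.

Record young_function Phi : Prop := YoungFunction {
  young_ge0 : forall x : R, (0 <= x)%R -> 0 <= Phi x;
  young_neq0 : exists2 x : R, (0 <= x)%R & Phi x != 0;
  young_convex : forall x y t : R, (0 <= x)%R -> (0 <= y)%R -> (0 <= t <= 1)%R ->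
    Phi (t * x + (1 - t) * y)%R <= t%:E * Phi x + (1 - t)%:E * Phi y;
  young_at0 : Phi 0%R = 0;
  young_pinfty : Phi x @[x --> +oo%R] --> +oo
}.

Definition complementary Phi (y : R) : \bar R :=
  ereal_sup [set (x * y)%:E - Phi x | x in [set x : R | (0 <= x)%R]].

Definition complementary_pair Phi Psi : Prop :=
  [/\ young_function Phi, young_function Psi &
      forall y : R, (0 <= y)%R -> Psi y = complementary Phi y].

Definition continuous_increasing Phi : Prop :=
  {within `[0%R, +oo[%classic, continuous Phi} /\
  (forall x y : R, (0 <= x)%R -> (x < y)%R -> Phi x < Phi y).

End Young.

(* Elements of L^Phi are functions, not classes: two functions that agree
   almost everywhere are at distance 0 for the norms below, which are therefore
   seminorms on spaces of functions. *)
Section Orlicz.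
Context {R : realType} {G : topologicalZmodType}.
Variable mu : {measure set (borel G) -> \bar R}.
Implicit Types (f g v : G -> R[i]) (Phi : R -> \bar R) (omega : G -> R).

Definition cmeasurable f : Prop :=
  measurable_fun [set: borel G] (fun s : borel G => complex.Re (f s)) /\
  measurable_fun [set: borel G] (fun s : borel G => complex.Im (f s)).

Definition cintegral f : R[i] :=
  Complex (\int[mu]_(s in [set: borel G]) complex.Re (f s))
          (\int[mu]_(s in [set: borel G]) complex.Im (f s)).

(* Each integral is taken by its positive and negative parts; its value is
   meaningless at the points t where the integrand is not integrable. *)
Definition convolution f g : G -> R[i] :=
  fun t => cintegral (fun s => f s * g (t - s)).

Definition orlicz_space Phi : set (G -> R[i]) :=
  [set f | cmeasurable f /\
    exists2 a : R, 0 < a &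
      (\int[mu]_(s in [set: borel G]) Phi (a * normc (f s))%R < +oo)%E].

Definition orlicz_norm Phi f : \bar R :=
  ereal_sup [set (\int[mu]_(s in [set: borel G]) (normc (f s * v s))%:E)%E |
    v in [set v | cmeasurable v /\
      (\int[mu]_(s in [set: borel G]) complementary Phi (normc (v s)) <= 1)%E]].

Definition step_function f : Prop := cmeasurable f /\ finite_set (range f).

Definition orlicz_step_space Phi : set (G -> R[i]) :=
  [set f | orlicz_space Phi f /\
    forall e : R, 0 < e ->
      exists g, [/\ step_function g, orlicz_space Phi g &
        (orlicz_norm Phi (f - g)%R < e%:E)%E]].

Definition weigh omega f : G -> R[i] := fun s => f s * (omega s)%:C%C.

Definition weighted_space omega (A : set (G -> R[i])) : set (G -> R[i]) :=
  [set f | A (weigh omega f)].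

(* orlicz_norm is finite on orlicz_space, so fine loses nothing there. *)
Definition weighted_norm Phi omega f : R := fine (orlicz_norm Phi (weigh omega f)).

End Orlicz.

(* A is a subspace of V on which nrm is a seminorm; the Banach algebra is the
   quotient of A by the relation nrm (x - y) = 0, and the algebra identities are
   accordingly required up to vectors of norm 0. *)
Section BanachAlgebras.
Context {R : realType} {V : lmodType R[i]}.
Variables (A : set V) (mul : V -> V -> V) (nrm : V -> R).

Record banach_algebra : Prop := BanachAlgebra {
  ba_zero : A 0;
  ba_linear : forall (c : R[i]) x y, A x -> A y -> A (c *: x + y);
  ba_norm_ge0 : forall x, A x -> 0 <= nrm x;
  ba_normZ : forall (c : R[i]) x, A x -> nrm (c *: x) = normc c * nrm x;
  ba_normD : forall x y, A x -> A y -> nrm (x + y) <= nrm x + nrm y;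
  ba_complete : forall u : nat -> V, (forall n, A (u n)) ->
    (forall e : R, 0 < e -> exists N, forall p q,
      (N <= p)%N -> (N <= q)%N -> nrm (u p - u q) < e) ->
    exists2 l, A l & nrm (u n - l) @[n --> \oo] --> (0 : R);
  ba_mul : forall x y, A x -> A y -> A (mul x y);
  ba_mulPl : forall (c : R[i]) x y z, A x -> A y -> A z ->
    nrm (mul (c *: x + y) z - (c *: mul x z + mul y z)) = 0;
  ba_mulPr : forall (c : R[i]) x y z, A x -> A y -> A z ->
    nrm (mul z (c *: x + y) - (c *: mul z x + mul z y)) = 0;
  ba_mulA : forall x y z, A x -> A y -> A z ->
    nrm (mul x (mul y z) - mul (mul x y) z) = 0;
  ba_mul_bounded : exists K : R, forall x y, A x -> A y ->
    nrm (mul x y) <= K * nrm x * nrm y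
}.

(* phi represents an element of the dual space A^*; by boundedness it vanishes
   on vectors of norm 0. *)
Definition dual (phi : V -> R[i]) : Prop :=
  (forall (c : R[i]) x y, A x -> A y -> phi (c *: x + y) = c * phi x + phi y) /\
  (exists K : R, forall x, A x -> normc (phi x) <= K * nrm x).

(* A^* is an A-bimodule by (x . phi) z = phi (z x) and (phi . x) z = phi (x z). *)
Record bounded_derivation (D : V -> V -> R[i]) : Prop := BoundedDerivation {
  bd_dual : forall x, A x -> dual (D x);
  bd_linear : forall (c : R[i]) x y z, A x -> A y -> A z ->
    D (c *: x + y) z = c * D x z + D y z;
  bd_bounded : exists K : R, forall x z, A x -> A z ->
    normc (D x z) <= K * nrm x * nrm z;
  bd_leibniz : forall x y z, A x -> A y -> A z ->
    D (mul x y) z = D y (mul z x) + D x (mul y z)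
}.

Definition inner_derivation (D : V -> V -> R[i]) : Prop :=
  exists2 phi, dual phi & forall x z, A x -> A z ->
    D x z = phi (mul z x) - phi (mul x z).

Definition weakly_amenable : Prop :=
  forall D, bounded_derivation D -> inner_derivation D.

End BanachAlgebras.

(* Main.v *)
From HB Require Import structures.
Require Import Defs.
From mathcomp Require Import all_boot all_order all_algebra.
From mathcomp Require Import complex finmap.
From mathcomp Require Import all_classical all_reals all_analysis.
From mathcomp Require Import measurable_realfun.
From mathcomp Require Import ring lra zify.

(** Multiplication by a homomorphism is the derivation that refutes weak
amenability.

Non-compactness of [G] provides a continuous homomorphism [chi : G -> R] which is
bounded by 1 on the unit box, hence by the word length everywhere, and which is
nonzero: a coordinate of the Euclidean factor or of the integral factor.  Since
[chi] is additive, [x |-> chi x] obeys the Leibniz rule for the convolution, and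
so does the map [D] that sends [x] to the functional which takes [z] to the
integral over [B] of the convolution of [chi x] with [z], for a fixed set [B] of
finite measure.  An inner derivation [D] into the dual satisfies [D x x = 0], as
[D x x] is a difference of two equal terms, whereas [D x x > 0] for
[x = \1_V / omega] and [B = e + V], where [e] belongs to the open set [V] and [chi]
is positive on [V] ([chi_derivation_neq0]).  This [x] lies in both algebras, and
[D] restricts to the smaller one, so that one derivation serves for both.

The analytic point is that [D] is bounded.  It follows from a bound, for every
[t], of the integral in [s] of [(1 + |s|) |x s| |z (t - s)|] by a constant multiple
of [omega t] and of the norms of [x] and [z] ([weighted_convolution_bound]).  Put
[F = |x| omega], [H = |z| omega] and [y = a / omega] with [Psi y] integrable.  As
[omega s <= omega t * omega (t - s)], it suffices to bound [(1 + |s|) y^2 F^2], and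
the same expression for [H].  Word balls grow at least linearly
([haar_sumset_ge]) and [omega] increases with the length, so integrability of
[Psi y] forces [(1 + |s|) Psi y <= C] ([length_psi_bounded]).  Convexity of
[Phi] composed with the square root gives [F^2 y^2 <= 4 Psi y (Phi F + Psi y)]
([young_sqr_ineq]).  Hence [(1 + |s|) y^2 F^2 <= 4 C (Phi F + Psi y)], which is
integrable with a bound that depends only on the norm: the modular is at most 1
on the open unit ball of the Orlicz norm ([modular_le1]).

Fubini's theorem is avoided throughout, because subtraction on [G] need not be
measurable for the product of the Borel sigma-algebras when [G] is not second
countable.  Associativity is taken from the Banach algebra itself: truncating [x]
to the set where [|chi| <= n] keeps [chi x] in the algebra, the Leibniz rule for
truncated functions follows from associativity up to null functions and from
commutativity, and dominated convergence removes the truncation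
([chi_derivation_leibniz]).

Commutativity, and the equality of the modulars of [H] and of [s |-> H (t - s)],
amount to [mu (- A) = mu A] ([haar_opp]).  A discrete substitute for Fubini's
theorem gives [mu K * mu C <= mu (- C1) * mu (K + C1)] whenever [C1] contains a
neighbourhood [C - V] of the compact set [C] ([haar_sum_bound]).  If
[mu (- C1) < mu C], iteration makes the measure of [K + C1 + ... + C1] grow
exponentially in the number of terms, but in an abelian group it grows at most
polynomially.  So [mu C <= mu (- C1)], and regularity concludes. *)

Set Implicit Arguments.
Unset Strict Implicit.
Unset Printing Implicit Defensive.

Import Order.TTheory GRing.Theory Num.Theory.
Import numFieldNormedType.Exports.
Import Normc.

Local Open Scope classical_set_scope.
Local Open Scope ring_scope.

(** * Translates, sums and compact sets in a topological abelian group *)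

Section TopologicalGroup.
Context {G : topologicalZmodType}.
Implicit Types (A B C K N O : set G) (s t x : G).

Lemma continuous_addl s : continuous (fun t : G => s + t).
Proof.
move=> t; apply: (@continuous_comp _ _ _ (fun t => (s, t))
  (fun p : G * G => p.1 + p.2)); last exact: add_continuous.
by apply: cvg_pair; [exact: cvg_cst | exact: cvg_id].
Qed.

Lemma continuous_subl s : continuous (fun t : G => s - t).
Proof.
by move=> t; apply: (@continuous_comp _ _ _ (@GRing.opp G) (fun t => s + t));
  [exact: opp_continuous | exact: continuous_addl].
Qed.

Lemma open_addl s A : open A -> open [set t | A (s + t)].
Proof. by move=> oA; apply: open_comp => // t _; exact: continuous_addl. Qed.

Lemma open_subl s A : open A -> open [set t | A (s - t)].
Proof. by move=> oA; apply: open_comp => // t _; exact: continuous_subl. Qed.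

Lemma open_subr s A : open A -> open [set t | A (t - s)].
Proof.
move=> oA; rewrite (_ : [set _ | _] = [set t | A (- s + t)]); first exact: open_addl.
by apply/seteqP; split=> t /=; rewrite addrC.
Qed.

Lemma open_opp A : open A -> open [set t | A (- t)].
Proof. by move=> oA; apply: open_comp => // t _; exact: opp_continuous. Qed.

Lemma compact_opp K : compact K -> compact [set t | K (- t)].
Proof.
move=> cK; rewrite (_ : [set _ | _] = -%R @` K).
  apply: continuous_compact => //; apply: continuous_subspaceT.
  exact: opp_continuous.
by apply/seteqP; split=> [t /= Kt|t [u Ku <-]]; [exists (- t); rewrite ?opprK|
  rewrite /= opprK].
Qed.

Lemma compact_image2 (X Y Z : topologicalType) (f : X * Y -> Z)
    (K : set X) (L : set Y) :
  continuous f -> compact K -> compact L -> compact (f @` (K `*` L)).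
Proof.
move=> cf cK cL; apply: continuous_compact; last exact: compact_setX.
exact: continuous_subspaceT.
Qed.

Definition set_add A B : set G := (fun p : G * G => p.1 + p.2) @` (A `*` B).
Definition set_sub A B : set G := (fun p : G * G => p.1 - p.2) @` (A `*` B).

Lemma compact_add A B : compact A -> compact B -> compact (set_add A B).
Proof. by apply: compact_image2; exact: add_continuous. Qed.

Lemma compact_sub A B : compact A -> compact B -> compact (set_sub A B).
Proof. by apply: compact_image2; exact: sub_continuous. Qed.

Lemma compact_cover_translates K (V : set G) :
  compact K -> open V -> V 0 ->
  exists s : seq G, forall t, K t -> exists2 x, x \in s & V (t - x).
Proof.
(* The equivalence of compactness with the covering property is stated for
   pointed spaces; 0 is the point. *)
pose G' : ptopologicalType := HB.pack (G : Type) (Topological.on G)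
  (isPointed.Build G 0).
move=> cK oV V0.
have : @cover_compact G' K by rewrite -compact_cover.
move=> /(_ G setT (fun x => [set t | V (t - x)])) [x _|t Kt|D _ KD].
- exact: open_subr.
- by exists t => //=; rewrite subrr.
- by exists (enum_fset D) => t /KD[x /= xD Vx]; exists x.
Qed.

End TopologicalGroup.

Section BorelGroup.
Context {G : topologicalZmodType}.

Lemma open_borel (A : set G) : open A -> measurable (A : set (borel G)).
Proof. by move=> oA; apply: sub_sigma_algebra. Qed.

Lemma compact_borel (A : set G) : hausdorff_space G ->
  compact A -> measurable (A : set (borel G)).
Proof.
move=> hG cA; rewrite -(setCK A); apply: measurableC; apply: open_borel.
by apply: closed_openC; apply: compact_closed.
Qed.

Lemma continuous_borel (f : G -> G) : continuous f ->
  measurable_fun setT (f : borel G -> borel G).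
Proof.
move=> cf; apply: (@measurability _ _ (borel G) (borel G) setT f (@open G)) => //.
move=> _ [A oA <-]; rewrite setTI; apply: open_borel.
by apply: open_comp => // t _; exact: cf.
Qed.

Lemma continuous_borel_real (R : realType) (f : G -> R) : continuous f ->
  measurable_fun setT (f : borel G -> R).
Proof.
move=> cf; apply: (measurability _ (measurable_realfun.RGenOpens.measurableE R)).
move=> /= _ [_ [a [b ->] <-]].
rewrite setTI; apply: open_borel.
by apply: open_comp => [t _|]; [exact: cf|exact: interval_open].
Qed.

Lemma borel_addl (s : G) : measurable_fun setT (fun t : borel G => s + t : borel G).
Proof. by apply: continuous_borel; exact: continuous_addl. Qed.

Lemma borel_subl (s : G) : measurable_fun setT (fun t : borel G => s - t : borel G).
Proof. by apply: continuous_borel; exact: continuous_subl. Qed.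

Lemma measurable_addl (s : G) (A : set G) : measurable (A : set (borel G)) ->
  measurable ([set t | A (s + t)] : set (borel G)).
Proof. by move=> mA; have := @borel_addl s measurableT A mA; rewrite setTI. Qed.

Lemma measurable_subl (s : G) (A : set G) : measurable (A : set (borel G)) ->
  measurable ([set t | A (s - t)] : set (borel G)).
Proof. by move=> mA; have := @borel_subl s measurableT A mA; rewrite setTI. Qed.

Lemma measurable_subr (s : G) (A : set G) : measurable (A : set (borel G)) ->
  measurable ([set t | A (t - s)] : set (borel G)).
Proof.
move=> mA; rewrite (_ : [set _ | _] = [set t | A (- s + t)]); first exact: measurable_addl.
by apply/seteqP; split=> t /=; rewrite addrC.
Qed.

Lemma measurable_opp (A : set G) : measurable (A : set (borel G)) ->
  measurable ([set t | A (- t)] : set (borel G)).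
Proof.
move=> mA; have := @continuous_borel (@GRing.opp G) (@opp_continuous G).
by move=> /(_ measurableT A mA); rewrite setTI.
Qed.

End BorelGroup.

Lemma measurable_fun_indicE d (T : measurableType d) (R : realType) (A : set T) :
  measurable A -> measurable_fun setT (fun t => (\1_A t)%:E : \bar R).
Proof. by move=> mA; apply/measurable_EFinP; exact: measurable_indic. Qed.

(** * Haar measure: positivity on open sets and a discrete Fubini inequality *)

Section Haar.
Context {R : realType} {G : topologicalZmodType}.
Variable mu : {measure set (borel G) -> \bar R}.
Hypothesis hG : hausdorff_space G.
Hypothesis hmu : haar_measure mu.
Implicit Types (A C K O V W : set G) (s t : G).

Lemma haar_addl s A : measurable (A : set (borel G)) ->
  mu [set t | A (s + t)] = mu A.
Proof.
move=> mA; rewrite -(haar_translation hmu (- s) mA); congr (mu _).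
apply/seteqP; split=> [t /= At|t [u Au <-]]; last by rewrite /= addNKr.
by exists (s + t) => //; rewrite addKr.
Qed.

Lemma haar_addr s A : measurable (A : set (borel G)) ->
  mu [set t | A (t + s)] = mu A.
Proof.
move=> mA; rewrite -(haar_addl s mA); congr (mu _).
by apply/seteqP; split=> t /=; rewrite addrC.
Qed.

Lemma haar_cover (l : seq G) K V : measurable (K : set (borel G)) ->
  measurable (V : set (borel G)) ->
  (forall t, K t -> exists2 x, x \in l & V (t - x)) ->
  (mu K <= (size l)%:R%:E * mu V)%E.
Proof.
move=> mK mV KV; pose F i := [set t : borel G | V (t - nth 0 l i)].
have mF i : measurable (F i) by exact: measurable_subr.
apply: (@le_trans _ _ (\sum_(i < size l) mu (F i)))%E.
  apply: content_subadditive => // t /KV[x xl Vx].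
  rewrite -bigcup_mkord; exists (index x l); first by rewrite /= index_mem.
  by rewrite /F /= nth_index.
under eq_bigr do rewrite /F haar_addr//.
elim: (size l) => [|n ih]; first by rewrite big_ord0 mul0e.
by rewrite big_ord_recr /= -natr1 EFinD ge0_muleDl// mul1e leeD2r.
Qed.

(** A null nonempty open set would cover each compact set by finitely many null
translates, and by inner regularity the whole group would be null. *)
Lemma haar_open_gt0 V : open V -> V !=set0 -> (0 < mu V)%E.
Proof.
move=> oV [v Vv]; rewrite lt0e measure_ge0 andbT; apply/eqP => mu0.
apply: (haar_neq0 hmu); apply/eqP; rewrite eq_le measure_ge0 andbT.
rewrite (haar_inner_regular hmu (@openT G)); apply: ge_ereal_sup.
move=> _ [K [cK _] <-].
have oV' : open [set t | V (v + t)] by exact: open_addl.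
have [|l lK] := compact_cover_translates cK oV'; first by rewrite /= addr0.
have := @haar_cover l K [set t | V (v + t)] (compact_borel hG cK) (open_borel oV') lK.
by rewrite haar_addl ?mu0 ?mule0//; exact: open_borel.
Qed.

(** Formally this integrates the convolution of [\1_K] and [\1_C]: the integral
is [mu K * mu C], the support lies in [K + C] and the values are at most
[mu (- C)].  Fubini's theorem is replaced by the partition of [K] into finitely
many Borel pieces [E i], each inside a translate [x i + V]: the measure [mu] on
[K] becomes a finite sum of point masses [mu (E i)] at [x i], at the price of
enlarging [C] to [C1], which contains [C - V]. *)
Lemma haar_sum_bound (l : seq G) K C C1 V W :
  measurable (K : set (borel G)) -> measurable (C : set (borel G)) ->
  measurable (C1 : set (borel G)) -> measurable (V : set (borel G)) ->
  measurable (W : set (borel G)) ->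
  (forall t, K t -> exists2 x, x \in l & V (t - x)) ->
  (forall c v, C c -> V v -> C1 (c - v)) ->
  (forall k c, K k -> C1 c -> W (k + c)) ->
  (mu K * mu C <= mu [set t | C1 (- t)%R] * mu W)%E.
Proof.
move=> mK mC mC1 mV mW KV CV KC.
pose n := size l; pose x i := nth 0 l i.
pose F i : set (borel G) := K `&` [set t | V (t - x i)].
have mF i : measurable (F i) by apply: measurableI => //; exact: measurable_subr.
pose E := seqDU F.
have mE i : measurable (E i) by exact: seqDU_measurable.
have EF i : E i `<=` F i by apply: subDsetl.
have tE : trivIset setT E by exact: trivIset_seqDU.
have KE : mu K = (\sum_(i < n) mu (E i))%E.
  rewrite -(measure_bigsetU _ mE tE) -bigsetU_seqDU; congr (mu _).
  rewrite -bigcup_mkord; apply/seteqP; split=> [t Kt|t [i _ []]//].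
  have [y yl Vy] := KV _ Kt; exists (index y l); first by rewrite /= index_mem.
  by split=> //=; rewrite /x nth_index.
pose f i (t : borel G) :=
  (mu (E i) * (\1_([set t | C (t - x i)%R] : set (borel G)) t)%:E)%E.
have mf i : measurable_fun [set: borel G] (f i).
  apply: measurable_funeM.
  exact: (@measurable_fun_indicE _ (borel G) R _ (measurable_subr (x i) mC)).
have f0 i t : (0 <= f i t)%E by rewrite mule_ge0// lee_fin indicE.
have -> : (mu K * mu C = \int[mu]_t (\sum_(i < n) f i t))%E.
  rewrite ge0_integral_sum//; rewrite KE ge0_sume_distrl//.
  apply: eq_bigr => i _; rewrite ge0_integralZl//; last first.
    exact: (@measurable_fun_indicE _ (borel G) R _ (measurable_subr (x i) mC)).
  rewrite integral_indic//; last exact: measurable_subr.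
  by rewrite setIT; congr (_ * _)%E; rewrite -(haar_addr (- x i) mC).
have mW1 : measurable_fun [set: borel G] (fun t : borel G => (\1_W t)%:E : \bar R).
  exact: (@measurable_fun_indicE _ (borel G) R _ mW).
have -> : (mu [set t | C1 (- t)%R] * mu W =
    \int[mu]_t (mu [set t | C1 (- t)%R] * (\1_W t)%:E))%E.
  rewrite ge0_integralZl//; first by rewrite integral_indic// setIT.
apply: ge0_le_integral => //.
- by move=> t _; exact: sume_ge0.
- exact: emeasurable_sum.
- exact: measurable_funeM.
(* At [t], the sum is the measure of the pieces whose centre lies in [t - C];
   these pieces are contained in [t - C1]. *)
move=> t _; pose E' i := if `[< C (t - x i) >] then E i else set0.
have mE' i : measurable (E' i) by rewrite /E'; case: ifP.
have -> : (\sum_(i < n) f i t = \sum_(i < n) mu (E' i))%E.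
  apply: eq_bigr => i _; rewrite /f /E' indicE /=.
  case: (asboolP (C _)) => Ct; first by rewrite mem_set// mule1.
  by rewrite memNset// measure0 mule0.
rewrite -measure_bigsetU//; last first.
  by move=> i j _ _ [r]; rewrite /E'; do 2?[case: asboolP => _]; move=> [] // ? ?;
    apply: tE => //; exists r.
rewrite indicE; have [Wt|Wt] := boolP (t \in W).
  rewrite mule1.
  have <- : mu [set r | C1 (t - r)] = mu [set t | C1 (- t)].
    rewrite -(haar_addl (- t)%R (measurable_opp mC1)); congr (mu _).
    by apply/seteqP; split=> r /=; rewrite opprD opprK.
  apply: le_measure; rewrite ?inE.
  - exact: bigsetU_measurable.
  - exact: measurable_subl.
  - rewrite -bigcup_mkord => r [i _]; rewrite /E'; case: asboolP => // Ct.
    move=> /EF[_ /= Vr]; rewrite (_ : t - r = (t - x i) - (r - x i)); last first.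
      by rewrite opprB addrA subrK.
    exact: CV.
rewrite mule0 (_ : \big[_/_]_(_ < _) _ = set0) ?measure0//.
rewrite -bigcup_mkord -subset0 => r [i _]; rewrite /E'; case: asboolP => // Ct.
move=> /EF[Kr /= Vr]; move: Wt; rewrite notin_setE; apply.
rewrite (_ : t = r + ((t - x i) - (r - x i))); first by apply: KC => //; exact: CV.
by rewrite opprB [X in r + X]addrA (subrK (x i) t) [RHS]addrC (subrK r t).
Qed.

End Haar.

(** * Haar measure: invariance under inversion *)

(** An exponential of ratio [c / d > 1] outgrows a polynomial of degree [r]: with
[x = ln (c / d)], the term of degree [r + 1] of [expR (n * x)] already does. *)
Lemma pow_le_poly_contra (R : realType) (c d a M : R) (r : nat) :
  0 <= d -> d < c -> 0 < a ->
  (forall n, c ^+ n * a <= d ^+ n * (n.+1%:R ^+ r * M)) -> False.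
Proof.
move=> d0 dc a0 H; have c0 : 0 < c by exact: le_lt_trans dc.
have [d_eq0|d_neq0] := eqVneq d 0.
  have := H 1%N; rewrite d_eq0 !expr1 mul0r leNgt => /negP; apply.
  exact: mulr_gt0.
have {d0 d_neq0} d0 : 0 < d by rewrite lt0r d_neq0.
pose x := ln (c / d).
have x0 : 0 < x by rewrite ln_gt0// ltr_pdivlMr// mul1r.
have M0 : 0 <= M.
  have := H 0%N; rewrite !expr0 !mul1r expr1n mul1r; apply: le_trans.
  exact: ltW.
pose k := x ^+ r.+1 / r.+1`!%:R * a.
have k0 : 0 < k by rewrite mulr_gt0// divr_gt0 ?exprn_gt0// ltr0n fact_gt0.
have H1 n : n.+1%:R * k <= 2 ^+ r * M.
  have /(_ n.+1) := H; rewrite -ler_pdivrMl ?exprn_gt0// mulrA -exprVn -exprMn.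
  rewrite [_^-1 * c]mulrC => Hn.
  have : n.+1%:R ^+ r.+1 * k <= n.+2%:R ^+ r * M.
    apply: le_trans Hn; rewrite /k mulrA ler_wpM2r//; first exact: ltW.
    have cd0 : 0 < c / d by rewrite divr_gt0.
    rewrite -[c / d]lnK ?posrE// -/x -expRM_natl mulrA -exprMn.
    apply: le_trans (expR_ge1Dxn r _); last by rewrite mulr_ge0 ?ler0n ?(ltW x0).
    by rewrite lerDr.
  rewrite exprS => {}Hn.
  have n0 : 0 < n.+1%:R ^+ r :> R by rewrite exprn_gt0// ltr0n.
  rewrite -(ler_pM2r n0); apply: (le_trans (y := n.+2%:R ^+ r * M)).
    by apply: le_trans Hn; rewrite le_eqVlt; apply/orP; left; apply/eqP; ring.
  rewrite mulrAC ler_wpM2r// -exprMn lerXn2r ?nnegrE//.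
  by rewrite -natrM ler_nat; lia.
have /archi_boundP : 0 <= 2 ^+ r * M / k.
  apply: divr_ge0; last exact: ltW.
  by apply: mulr_ge0 => //; apply: exprn_ge0.
set n := Num.bound _; rewrite ltr_pdivrMr// ltNge => /negP; apply.
apply: le_trans (H1 n); rewrite ler_wpM2r ?(ltW k0)// ler_nat; lia.
Qed.

Section HaarSymmetric.
Context {R : realType} {G : topologicalZmodType}.
Variable mu : {measure set (borel G) -> \bar R}.
Hypothesis hG : hausdorff_space G.
Hypothesis lcG : locally_compact [set: G].
Hypothesis hmu : haar_measure mu.
Implicit Types (A C K O V W : set G) (s t : G).

Lemma compact_nbhs0 : exists2 N : set G, compact N & nbhs 0 N.
Proof.
have [N] : compact_near (within [set: G] (nbhs 0)) by apply: (lcG (x := 0)).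
by rewrite withinET => N0 [cN _]; exists N.
Qed.

Lemma compact_sub_nbhs0 C O : compact C -> open O -> C `<=` O ->
  \forall v \near (0 : G), forall c, C c -> O (c - v).
Proof.
move=> /compact_near_coveringP cC oO CO.
apply: (cC G (nbhs 0) (fun v c => O (c - v))) => c Cc.
have Oc : nbhs (c - 0) O.
  by apply: open_nbhs_nbhs; split => //; rewrite subr0; exact: CO.
exact: (@sub_continuous G (c, 0)).
Qed.

(** Polynomial growth: if [P + P] is covered by the translates of [P] by the list
[l], then, the group being abelian, the [n]-fold sum is covered by the
translates by the combinations of [l] whose coefficients are at most [n]. *)
Lemma iter_add_cover (P : set G) (l : seq G) (W : nat -> set G) :
  (forall p q, P p -> P q -> exists2 x, x \in l & P (p + q - x)) ->
  W 0%N `<=` P -> (forall n, W n.+1 `<=` set_add (W n) P) ->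
  forall n t, W n t -> exists2 a : 'I_(size l) -> nat,
    (forall i, a i <= n)%N & P (t - \sum_(i < size l) nth 0 l i *+ a i).
Proof.
move=> Pl W0 WS; elim=> [|n ih] t.
  move=> /W0 Pt; exists (fun=> 0%N) => //.
  by rewrite big1 ?subr0// => i _; rewrite mulr0n.
move=> /WS[[w p] /= [/ih[a an Pw] Pp] <-].
have [x xl Px] := Pl _ _ Pw Pp.
have il : (index x l < size l)%N by rewrite index_mem.
pose i0 := Ordinal il.
exists (fun i => a i + (i == i0))%N => [i|].
  by rewrite -addn1 leq_add// leq_b1.
rewrite (_ : \sum_(i < size l) _ = \sum_(i < size l) nth 0 l i *+ a i + x); last first.
  under eq_bigr do rewrite mulrnDr.
  rewrite big_split /=; congr (_ + _).
  rewrite (bigD1 i0)//= eqxx nth_index// big1 ?addr0// => i /negbTE ->.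
  by rewrite mulr0n.
by rewrite opprD addrA (addrAC w p).
Qed.

Lemma haar_iter_add_le (P : set G) (l : seq G) (W : nat -> set G) :
  measurable (P : set (borel G)) -> (forall n, measurable (W n : set (borel G))) ->
  (forall p q, P p -> P q -> exists2 x, x \in l & P (p + q - x)) ->
  W 0%N `<=` P -> (forall n, W n.+1 `<=` set_add (W n) P) ->
  forall n, (mu (W n) <= (n.+1%:R ^+ size l)%:E * mu P)%E.
Proof.
move=> mP mW Pl W0 WS n.
pose e := [seq \sum_(i < size l) nth 0 l i *+ f i | f : {ffun 'I_(size l) -> 'I_n.+1}].
have := @haar_cover R G mu hmu e (W n) P (mW n) mP.
rewrite size_map -cardE card_ffun !card_ord natrX; apply => t Wt.
have [a an Pa] := iter_add_cover Pl W0 WS Wt.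
exists (\sum_(i < size l) nth 0 l i *+ a i) => //; apply/mapP.
exists [ffun i => inord (a i)]; first by rewrite mem_enum.
by apply: eq_bigr => i _; rewrite ffunE inordK// ltnS.
Qed.

(** Choose [V] near 0 with [C1 = C - V] inside [O].  If [mu (- C1) < mu C], then
[haar_sum_bound], applied to the sums [W n] of a neighbourhood of 0 with [n]
copies of [C1], makes [mu (W n)] grow exponentially, against the polynomial
bound of [haar_iter_add_le]. *)
Lemma haar_le_opp_open C O : compact C -> open O -> C `<=` O ->
  (mu C <= mu [set t | O (- t)%R])%E.
Proof.
move=> cC oO CO; rewrite leNgt; apply/negP => OC.
have [N cN N0] := compact_nbhs0.
pose V := [set v | forall c, C c -> O (c - v)]° `&` N°.
have oV : open V by apply: openI; exact: open_interior.
have V0 : V 0 by split => //; exact: compact_sub_nbhs0.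
have VN : V `<=` N by move=> v [_ /interior_subset].
pose C1 := set_sub C V.
have C1O : C1 `<=` O by move=> _ [[c v] /= [Cc [/interior_subset Vv _]] <-]; exact: Vv.
have oadd (A B : set G) : open A -> open (set_add A B).
  move=> oA; rewrite (_ : set_add A B = \bigcup_(b in B) [set t | A (t - b)]).
    by apply: bigcup_open => b _; exact: open_subr.
  apply/seteqP; split=> [_ [[a b] /= [Aa Bb] <-]|t [b Bb /= Ab]].
    by exists b => //=; rewrite addrK.
  by exists (t - b, b) => //=; rewrite subrK.
have oC1 : open C1.
  rewrite (_ : C1 = \bigcup_(c in C) [set t | V (c - t)]).
    by apply: bigcup_open => b _; exact: open_subl.
  apply/seteqP; split=> [_ [[a b] /= [Aa Bb] <-]|t [b Bb /= Ab]].
    by exists a => //=; rewrite opprB addrC subrK.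
  by exists (b, b - t) => //=; rewrite opprB addrC subrK.
pose P := N `|` set_sub C N.
have cP : compact P by apply: compactU => //; exact: compact_sub.
have C1P : C1 `<=` P.
  by move=> _ [[c v] /= [Cc Vv] <-]; right; exists (c, v) => //; split => //; exact: VN.
have oN : open N° by exact: open_interior.
have [l lP] := compact_cover_translates (compact_add cP cP) oN N0.
have {}lP p q : P p -> P q -> exists2 x, x \in l & P (p + q - x).
  move=> Pp Pq; have [|x xl Nx] := lP (p + q); first by exists (p, q).
  by exists x => //; left; exact: interior_subset Nx.
pose W := fix W n : set G := if n is n'.+1 then set_add (W n') C1 else N°.
have oW n : open (W n) by elim: n => [|n ih]//=; exact: oadd.
have mW n : measurable (W n : set (borel G)) by exact: open_borel.
pose Q := fix Q n : set G := if n is n'.+1 then set_add (Q n') P else P.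
have cQ n : compact (Q n) by elim: n => [|n ih]//=; exact: compact_add.
have WQ n : W n `<=` Q n.
  elim: n => [|n ih]/=; first by move=> t /interior_subset; left.
  move=> _ [[w c] /= [Ww Cc] <-]; exists (w, c) => //=; split; first exact: ih.
  exact: C1P.
have W_fin n : mu (W n) \is a fin_num.
  rewrite ge0_fin_numE//; apply: le_lt_trans (haar_compact hmu (cQ n)).
  by apply: le_measure; rewrite ?inE//; exact: compact_borel.
have C_fin : mu C \is a fin_num by rewrite ge0_fin_numE//; exact: haar_compact.
have P_fin : mu P \is a fin_num by rewrite ge0_fin_numE//; exact: haar_compact.
have mC1 : measurable (C1 : set (borel G)) by exact: open_borel.
have dC : (mu [set t | C1 (- t)%R] < mu C)%E.
  apply: le_lt_trans OC; apply: le_measure; rewrite ?inE.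
  - exact: measurable_opp.
  - by apply: measurable_opp; exact: open_borel.
  - by move=> t /=; exact: C1O.
have d_fin : mu [set t | C1 (- t)%R] \is a fin_num.
  by rewrite ge0_fin_numE//; apply: lt_le_trans dC _; rewrite leey.
have step n : (mu (W n) * mu C <= mu [set t | C1 (- t)%R] * mu (W n.+1))%E.
  have [s sQ] := compact_cover_translates (cQ n) oV V0.
  apply: (haar_sum_bound hmu (l := s) (V := V)) => //.
  - exact: compact_borel.
  - exact: open_borel.
  - by move=> t /WQ Qt; exact: sQ.
  - by move=> c v Cc Vv; exists (c, v).
  - by move=> w c Ww Cc; exists (w, c).
apply: (@pow_le_poly_contra R (fine (mu C)) (fine (mu [set t | C1 (- t)%R]))
    (fine (mu (W 0%N))) (fine (mu P)) (size l)).
- exact: fine_ge0.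
- by rewrite -lte_fin !fineK.
- rewrite -lte_fin fineK//; apply: haar_open_gt0 => //.
  by exists 0.
- move=> n; apply: (@le_trans _ _ (fine (mu [set t | C1 (- t)%R]) ^+ n * fine (mu (W n)))).
    elim: n => [|n ih]; first by rewrite !expr0 !mul1r.
    have stepR : fine (mu (W n)) * fine (mu C) <=
        fine (mu [set t | C1 (- t)%R]) * fine (mu (W n.+1)).
      by rewrite -lee_fin !EFinM !fineK.
    rewrite exprS -mulrA; apply: (le_trans (ler_wpM2l _ ih)); first exact: fine_ge0.
    rewrite mulrCA exprSr -mulrA ler_wpM2l ?exprn_ge0 ?fine_ge0//.
    by rewrite mulrC.
  rewrite ler_wpM2l ?exprn_ge0 ?fine_ge0//.
  rewrite -lee_fin EFinM !fineK//.
  apply: (haar_iter_add_le (l := l)) => //.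
  + exact: compact_borel.
  + move=> m _ [[w c] /= [Ww Cc] <-]; exists (w, c) => //=; split => //.
    exact: C1P.
Qed.

Lemma haar_opp_compact C : compact C -> mu [set t | C (- t)%R] = mu C.
Proof.
suff H K : compact K -> (mu K <= mu [set t | K (- t)%R])%E.
  move=> cC; apply/eqP; rewrite eq_le H// andbT.
  have := H _ (compact_opp cC); congr (_ <= mu _)%E.
  by apply/seteqP; split=> t /=; rewrite opprK.
move=> cK; have mK := measurable_opp (compact_borel hG cK).
rewrite (haar_outer_regular hmu mK).
apply: le_ereal_inf_tmp => _ [V [oV KV] <-].
have := @haar_le_opp_open K [set t | V (- t)%R] cK (open_opp oV).
rewrite (_ : [set t | [set t0 | V (- t0)] (- t)] = V); last first.
  by apply/seteqP; split=> t /=; rewrite opprK.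
by apply=> t Kt; apply: KV => /=; rewrite opprK.
Qed.

Lemma haar_opp_open V : open V -> mu [set t | V (- t)%R] = mu V.
Proof.
suff H O : open O -> (mu O <= mu [set t | O (- t)%R])%E.
  move=> oV; apply/eqP; rewrite eq_le H// andbT.
  have := H _ (open_opp oV); congr (_ <= mu _)%E.
  by apply/seteqP; split=> t /=; rewrite opprK.
move=> oO; rewrite (haar_inner_regular hmu oO).
apply: ge_ereal_sup => _ [K [cK KO] <-]; rewrite -(haar_opp_compact cK).
apply: le_measure; rewrite ?inE.
- by apply: measurable_opp; exact: compact_borel.
- by apply: measurable_opp; exact: open_borel.
- by move=> t /=; exact: KO.
Qed.

(** The equality on compact sets passes to open sets by inner regularity and to
Borel sets by outer regularity; at each stage one inequality suffices, because
inversion is an involution. *)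
Lemma haar_opp A : measurable (A : set (borel G)) ->
  mu [set t | A (- t)%R] = mu A.
Proof.
suff H B : measurable (B : set (borel G)) -> (mu [set t | B (- t)%R] <= mu B)%E.
  move=> mA; apply/eqP; rewrite eq_le H//=.
  have := H _ (measurable_opp mA); congr (mu _ <= _)%E.
  by apply/seteqP; split=> t /=; rewrite opprK.
move=> mB; rewrite (haar_outer_regular hmu mB).
apply: le_ereal_inf_tmp => _ [V [oV BV] <-]; rewrite -(haar_opp_open oV).
apply: le_measure; rewrite ?inE.
- exact: measurable_opp.
- by apply: measurable_opp; exact: open_borel.
- by move=> t /=; exact: BV.
Qed.

End HaarSymmetric.

(** * Invariance of the Haar integral *)

Section HaarIntegral.
Context {R : realType} {G : topologicalZmodType}.
Variable mu : {measure set (borel G) -> \bar R}.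
Hypothesis hG : hausdorff_space G.
Hypothesis lcG : locally_compact [set: G].
Hypothesis hmu : haar_measure mu.

Lemma haar_subl (t : G) (A : set G) : measurable (A : set (borel G)) ->
  mu [set s | A (t - s)%R] = mu A.
Proof.
move=> mA; rewrite -(haar_addl hmu t mA).
by rewrite -(haar_opp hG lcG hmu (measurable_addl t mA)).
Qed.

Local Open Scope ereal_scope.

Lemma haar_ge0_integral_subl (t : G) (f : borel G -> \bar R) :
  measurable_fun [set: borel G] f -> (forall s, 0 <= f s) ->
  \int[mu]_s f (t - s)%R = \int[mu]_s f s.
Proof.
move=> mf f0.
have := @ge0_integral_pushforward _ _ (borel G) (borel G) R _ (@borel_subl G t)
  mu setT f measurableT mf (fun s _ => f0 s).
rewrite preimage_setT => <-.
apply: eq_measure_integral => mT A mA; last by move=> _; exact: haar_subl.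
exact: borel_subl.
Qed.

Lemma haar_integral_subl (t : G) (f : borel G -> \bar R) :
  measurable_fun [set: borel G] f ->
  \int[mu]_s f (t - s)%R = \int[mu]_s f s.
Proof.
move=> mf; rewrite [LHS]integralE [RHS]integralE; congr (_ - _).
  rewrite -(haar_ge0_integral_subl t (measurable_funepos mf) (funepos_ge0 _)).
  by apply: eq_integral => s _; rewrite !funeposE.
rewrite -(haar_ge0_integral_subl t (measurable_funeneg mf) (funeneg_ge0 _)).
by apply: eq_integral => s _; rewrite !funenegE.
Qed.

End HaarIntegral.

(** * Young functions *)

Section YoungReal.
Context {R : realType}.
Implicit Types (Y : R -> \bar R) (x y t : R).

(** Only the restriction of [Y] to the nonnegative reals is meaningful; composing
with [Num.max 0] yields a function that is monotone, hence measurable, on the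
whole line. *)
Definition yfun Y x : R := fine (Y (Num.max 0 x)).

Section YoungValues.
Variable Y : R -> \bar R.
Hypotheses (yY : young_function Y)
  (iY : forall x y : R, 0 <= x -> x < y -> (Y x < Y y)%E).

Lemma yfunE x : 0 <= x -> Y x = (yfun Y x)%:E.
Proof.
move=> x0; rewrite /yfun max_r// fineK// ge0_fin_numE ?young_ge0//.
have x1 : x < x + 1 by rewrite ltrDl.
by apply: lt_le_trans (iY x0 x1) _; rewrite leey.
Qed.

Lemma yfun_le0 x : x <= 0 -> yfun Y x = 0.
Proof. by move=> x0; rewrite /yfun max_l// (young_at0 yY). Qed.

Lemma yfun0 : yfun Y 0 = 0. Proof. exact: yfun_le0. Qed.

Lemma yfun_gt0 x : 0 < x -> 0 < yfun Y x.
Proof.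
move=> x0; rewrite -lte_fin -yfunE ?ltW//; apply: le_lt_trans (iY _ x0) => //.
by rewrite (young_at0 yY).
Qed.

Lemma yfun_ge0 x : 0 <= yfun Y x.
Proof. by case: (lerP x 0) => [/yfun_le0 ->//|/yfun_gt0/ltW]. Qed.

Lemma yfun_mono : {homo yfun Y : x y / x <= y}.
Proof.
move=> x y; case: (lerP x 0) => [/yfun_le0 -> _|x0]; first exact: yfun_ge0.
rewrite le_eqVlt => /predU1P[->//|xy].
have y0 : 0 < y by exact: lt_trans xy.
by apply: ltW; rewrite -lte_fin -!yfunE ?ltW//; apply: iY => //; exact: ltW.
Qed.

Lemma measurable_yfun : measurable_fun setT (yfun Y).
Proof. by apply: nondecreasing_measurable => //; exact: yfun_mono. Qed.

Lemma yfun_convex0 t x : 0 <= t <= 1 -> 0 <= x -> yfun Y (t * x) <= t * yfun Y x.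
Proof.
move=> /andP[t0 t1] x0.
have := young_convex yY x0 (lexx 0) (introT andP (conj t0 t1)).
rewrite mulr0 addr0 (young_at0 yY) mule0 adde0 !yfunE ?mulr_ge0//.
Qed.

(** Convexity and the value 0 at 0: chords through the origin get steeper *)
Lemma yfun_slope_mono : {homo (fun x => yfun Y x / x) : x y / x <= y}.
Proof.
move=> x y xy; case: (lerP x 0) => [x0|x0].
  rewrite (yfun_le0 x0) mul0r; case: (lerP y 0) => [/yfun_le0 ->|y0]; first by rewrite mul0r.
  by rewrite divr_ge0 ?yfun_ge0// ltW.
have y0 : 0 < y by exact: lt_le_trans xy.
have t01 : 0 <= x / y <= 1.
  by apply/andP; split; [rewrite divr_ge0 ?(ltW x0) ?(ltW y0)|rewrite ler_pdivrMr// mul1r].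
have := yfun_convex0 t01 (ltW y0); rewrite divfK ?gt_eqF// mulrAC ler_pdivlMr//.
by move=> H; rewrite ler_pdivrMr// mulrAC ler_pdivlMr// [yfun Y y * x]mulrC.
Qed.

Lemma yfun_scale_ge n x : 0 <= x -> n%:R * yfun Y x <= yfun Y (n%:R * x).
Proof.
case: n => [|n] x0; first by rewrite !mul0r yfun0.
have n0 : 0 < n.+1%:R :> R by rewrite ltr0n.
rewrite -ler_pdivlMl//.
have := @yfun_convex0 n.+1%:R^-1 (n.+1%:R * x).
rewrite mulKf ?gt_eqF//; apply; last by rewrite mulr_ge0// ler0n.
by rewrite invr_ge0 ler0n invf_le1// ler1n.
Qed.

End YoungValues.

Variables Phi Psi : R -> \bar R.
Hypotheses (pair : complementary_pair Phi Psi)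
  (ciPhi : continuous_increasing Phi) (ciPsi : continuous_increasing Psi).
Let yPhi : young_function Phi. Proof. by case: pair. Qed.
Let yPsi : young_function Psi. Proof. by case: pair. Qed.
Local Notation phi := (yfun Phi).
Local Notation psi := (yfun Psi).

Lemma young_ineq x y : 0 <= x -> 0 <= y -> x * y <= phi x + psi y.
Proof.
move=> x0 y0; have [_ _ /(_ y y0)] := pair.
rewrite (yfunE yPsi ciPsi.2 y0) => psiE.
rewrite addrC -lerBlDr -lee_fin psiE EFinB -(yfunE yPhi ciPhi.2 x0).
by apply: ereal_sup_ubound; exists x.
Qed.

(** The chord slope [phi x / x] replaces the derivative of [phi] as a test function
for the Orlicz norm: it is monotone, hence measurable, without any choice of a
subgradient.  For [u <= x] the quantity [u * (phi x / x) - phi u] is at most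
[phi x], and for [x < u] it is nonpositive since slopes increase. *)
Lemma young_conj_slope x : 0 < x -> psi (phi x / x) <= phi x.
Proof.
move=> x0; have p0 := yfun_ge0 yPhi ciPhi.2 x.
have q0 : 0 <= phi x / x by rewrite divr_ge0// ltW.
rewrite -lee_fin -(yfunE yPsi ciPsi.2 q0); have [_ _ ->//] := pair.
apply: ge_ereal_sup => _ [u /= u0 <-].
rewrite (yfunE yPhi ciPhi.2 u0) -EFinB lee_fin.
have [ux|xu] := leP u x.
  apply: (@le_trans _ _ (u * (phi x / x))).
    by rewrite gerBl (yfun_ge0 yPhi ciPhi.2).
  by rewrite mulrCA ler_piMr// ler_pdivrMr// mul1r.
apply: le_trans p0; rewrite subr_le0.
have u1 : 0 < u by exact: lt_trans xu.
rewrite mulrC -ler_pdivlMr//.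
exact: (yfun_slope_mono yPhi ciPhi.2 (ltW xu)).
Qed.

Hypothesis yPhi_sqrt : young_function (fun x => Phi (Num.sqrt x)).

(** This is where the convexity of [Phi] composed with the square root enters.  If
[phi x <= psi y], Young's inequality gives [x * y <= 2 * psi y].  Otherwise
scale [x] by the square root of [l = psi y / phi x < 1]: convexity gives
[phi (sqrt l * x) <= l * phi x = psi y], which is the first case. *)
Lemma young_sqr_ineq x y : 0 <= x -> 0 <= y ->
  x ^+ 2 * y ^+ 2 <= 4 * psi y * (phi x + psi y).
Proof.
move=> x0 y0; have p0 := yfun_ge0 yPhi ciPhi.2; have q0 := yfun_ge0 yPsi ciPsi.2.
have [pq|qp] := leP (phi x) (psi y).
  have H : x * y <= 2 * psi y by have := young_ineq x0 y0; lra.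
  rewrite -exprMn; apply: (@le_trans _ _ ((2 * psi y) ^+ 2)).
    by rewrite lerXn2r ?nnegrE ?mulr_ge0.
  have := q0 y; have := p0 x; nra.
have px : 0 < phi x by exact: le_lt_trans qp.
pose l := psi y / phi x.
have l0 : 0 <= l by rewrite divr_ge0.
have l1 : l <= 1 by rewrite ler_pdivrMr// mul1r ltW.
have pl : phi (Num.sqrt l * x) <= psi y.
  have := @young_convex R _ yPhi_sqrt (x ^+ 2) 0 l (sqr_ge0 x) (lexx 0).
  rewrite l0 l1 => /(_ isT); rewrite mulr0 addr0 sqrtr0 (young_at0 yPhi) mule0 adde0.
  rewrite sqrtrM// sqrtr_sqr ger0_norm//.
  by rewrite !(yfunE yPhi ciPhi.2) ?mulr_ge0 ?sqrtr_ge0// lee_fin divfK ?gt_eqF.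
have H : Num.sqrt l * x * y <= 2 * psi y.
  have := @young_ineq (Num.sqrt l * x) y; rewrite mulr_ge0 ?sqrtr_ge0//.
  by move=> /(_ isT y0); lra.
have H2 : l * (x ^+ 2 * y ^+ 2) <= 4 * psi y ^+ 2.
  rewrite -[l]sqr_sqrtr// mulrA -!exprMn; apply: (@le_trans _ _ ((2 * psi y) ^+ 2)).
    by rewrite lerXn2r ?nnegrE ?mulr_ge0 ?sqrtr_ge0.
  by rewrite le_eqVlt; apply/predU1P; left; ring.
have [y_eq0|y_neq0] := eqVneq y 0.
  by rewrite y_eq0 expr0n mulr0 !mulr_ge0// addr_ge0.
have y1 : 0 < y by rewrite lt0r y_neq0.
have py : 0 < psi y by exact: (yfun_gt0 yPsi ciPsi.2).
have H3 : x ^+ 2 * y ^+ 2 <= 4 * psi y * phi x.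
  have l2 : 0 < l by rewrite divr_gt0.
  rewrite -(ler_pM2l l2); apply: le_trans H2 _.
  by rewrite le_eqVlt; apply/predU1P; left; rewrite /l; field; rewrite gt_eqF.
by apply: le_trans H3 _; rewrite ler_wpM2l ?mulr_ge0// lerDl.
Qed.

End YoungReal.

(** * Integration of complex functions *)

Section ComplexNorm.
Context {R : realType}.
Implicit Types z w : R[i].

Lemma normc_ge0 z : 0 <= normc z.
Proof. by case: z => a b /=; exact: sqrtr_ge0. Qed.

Lemma ler_Re_normc z : `|complex.Re z| <= normc z.
Proof.
case: z => a b /=; rewrite -sqrtr_sqr ler_wsqrtr// lerDl; exact: sqr_ge0.
Qed.

Lemma ler_Im_normc z : `|complex.Im z| <= normc z.
Proof.
case: z => a b /=; rewrite -sqrtr_sqr ler_wsqrtr// lerDr; exact: sqr_ge0.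
Qed.

Lemma ler_normc_ReIm z : normc z <= `|complex.Re z| + `|complex.Im z|.
Proof.
case: z => a b /=; rewrite -[leRHS]ger0_norm ?addr_ge0// -sqrtr_sqr ler_wsqrtr//.
rewrite sqrrD !real_normK ?num_real// lerD2r lerDl mulrn_wge0// mulr_ge0//.
Qed.

Lemma normc_real (x : R) : normc x%:C%C = `|x|.
Proof. by rewrite /= expr0n addr0 sqrtr_sqr. Qed.

Lemma ReM z w : complex.Re (z * w) =
  complex.Re z * complex.Re w - complex.Im z * complex.Im w.
Proof. by case: z w => a b [c d]. Qed.

Lemma ImM z w : complex.Im (z * w) =
  complex.Re z * complex.Im w + complex.Im z * complex.Re w.
Proof. by case: z w => a b [c d]. Qed.

Lemma ReD z w : complex.Re (z + w) = complex.Re z + complex.Re w.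
Proof. by case: z w => a b [c d]. Qed.

Lemma ImD z w : complex.Im (z + w) = complex.Im z + complex.Im w.
Proof. by case: z w => a b [c d]. Qed.

(** Convergence of the two coordinates: real integration theory applies to each of
them. *)
Definition ccvg (u : nat -> R[i]) (l : R[i]) : Prop :=
  (complex.Re (u n) @[n --> \oo] --> complex.Re l) /\
  (complex.Im (u n) @[n --> \oo] --> complex.Im l).

Lemma ccvg_unique u l l' : ccvg u l -> ccvg u l' -> l = l'.
Proof.
case: l l' => [a b] [a' b'] [/= ua ub] [/= ua' ub'].
by congr Complex; [apply: cvg_unique ua ua'|apply: cvg_unique ub ub'] => //.
Qed.

Lemma ccvg_cst l : ccvg (fun=> l) l.
Proof. by split; exact: cvg_cst. Qed.

Lemma ccvgD u v l k : ccvg u l -> ccvg v k -> ccvg (fun n => u n + v n) (l + k).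
Proof.
move=> [ua ub] [va vb]; split; rewrite (ReD, ImD).
  under eq_fun do rewrite ReD; exact: cvgD.
under eq_fun do rewrite ImD; exact: cvgD.
Qed.

Lemma ccvgM u v l k : ccvg u l -> ccvg v k -> ccvg (fun n => u n * v n) (l * k).
Proof.
move=> [ua ub] [va vb]; split; rewrite (ReM, ImM).
  under eq_fun do rewrite ReM; by apply: cvgB; exact: cvgM.
under eq_fun do rewrite ImM; by apply: cvgD; exact: cvgM.
Qed.

Lemma ccvg_near_cst u l N : (forall n, (N <= n)%N -> u n = l) -> ccvg u l.
Proof.
move=> ul; split; apply: (@cvg_near_cst _ _ _ _ \oo) => //;
  by exists N => // n /= /ul ->.
Qed.

End ComplexNorm.

Section ComplexIntegral.
Context {R : realType} {G : topologicalZmodType}.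
Variable mu : {measure set (borel G) -> \bar R}.
Implicit Types (f g : G -> R[i]) (u v : G -> R).

Definition rmeasurable u := measurable_fun [set: borel G] (u : borel G -> R).

Definition nint u : \bar R := \int[mu]_(s in [set: borel G]) (u s)%:E.

Lemma rmeasurableE u : rmeasurable u ->
  measurable_fun [set: borel G] (fun s : borel G => (u s)%:E : \bar R).
Proof. by move=> um; apply/measurable_EFinP. Qed.

Lemma rmeasurableM u v : rmeasurable u -> rmeasurable v ->
  rmeasurable (fun s => u s * v s).
Proof. exact: measurable_funM. Qed.

Lemma rmeasurableD u v : rmeasurable u -> rmeasurable v ->
  rmeasurable (fun s => u s + v s).
Proof. exact: measurable_funD. Qed.

Lemma rmeasurable_cst (c : R) : rmeasurable (fun=> c).
Proof. exact: measurable_cst. Qed.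

Lemma rmeasurable_indic (A : set G) : measurable (A : set (borel G)) ->
  rmeasurable (\1_A).
Proof. by move=> mA; exact: (@measurable_indic _ (borel G) R setT A). Qed.

Lemma rmeasurable_comp (h : R -> R) u : measurable_fun setT h -> rmeasurable u ->
  rmeasurable (fun s => h (u s)).
Proof. by move=> mh um; exact: (measurableT_comp mh um). Qed.

Lemma rmeasurable_subl (t : G) u : rmeasurable u -> rmeasurable (fun s => u (t - s)).
Proof. by move=> um; exact: (measurableT_comp um (@borel_subl G t)). Qed.

Lemma nint_ge0 u : (forall s, 0 <= u s) -> (0 <= nint u)%E.
Proof. by move=> u0; apply: integral_ge0 => s _; rewrite lee_fin. Qed.

Lemma nint_le u v : rmeasurable u -> rmeasurable v -> (forall s, 0 <= u s) ->
  (forall s, u s <= v s) -> (nint u <= nint v)%E.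
Proof.
move=> um mv u0 uv; apply: ge0_le_integral => //.
- by move=> s _; rewrite lee_fin.
- exact: rmeasurableE.
- exact: rmeasurableE.
- by move=> s _; rewrite lee_fin.
Qed.

Lemma nintZ (c : R) u : 0 <= c -> rmeasurable u -> (forall s, 0 <= u s) ->
  nint (fun s => c * u s) = (c%:E * nint u)%E.
Proof.
move=> c0 um u0; rewrite /nint; under eq_integral do rewrite EFinM.
rewrite ge0_integralZl//; try exact: rmeasurableE.
by move=> s _; rewrite lee_fin.
Qed.

Lemma nintD u v : rmeasurable u -> rmeasurable v -> (forall s, 0 <= u s) ->
  (forall s, 0 <= v s) -> nint (fun s => u s + v s) = (nint u + nint v)%E.
Proof.
move=> um mv u0 v0; rewrite /nint; under eq_integral do rewrite EFinD.
by rewrite ge0_integralD//; try exact: rmeasurableE;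
  move=> s _; rewrite lee_fin.
Qed.

Lemma nint_integrable u : rmeasurable u -> (nint (fun s => `|u s|%R) < +oo)%E ->
  mu.-integrable [set: borel G] (fun s => (u s)%:E).
Proof. by move=> um u_fin; apply/integrableP; split => //; exact: rmeasurableE. Qed.

Lemma cmeasurable_normc f : cmeasurable f -> rmeasurable (fun s => normc (f s)).
Proof.
move=> [mr mi]; rewrite (_ : (fun s => _) = fun s =>
    Num.sqrt (complex.Re (f s) ^+ 2 + complex.Im (f s) ^+ 2)); last first.
  by apply/funext => s; case: (f s).
have msqrt : measurable_fun [set: R] (@Num.sqrt R).
  by apply: nondecreasing_measurable => // x y; exact: ler_wsqrtr.
apply: (measurableT_comp msqrt).
by apply: measurable_funD; exact: measurable_funX.
Qed.

Lemma cmeasurableM f g : cmeasurable f -> cmeasurable g ->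
  cmeasurable (fun s => f s * g s).
Proof.
move=> [fr fi] [gr gi]; split.
  under eq_fun do rewrite ReM; apply: measurable_funB; exact: measurable_funM.
under eq_fun do rewrite ImM; apply: measurable_funD; exact: measurable_funM.
Qed.

Lemma cmeasurableD f g : cmeasurable f -> cmeasurable g ->
  cmeasurable (fun s => f s + g s).
Proof.
move=> [fr fi] [gr gi]; split.
  under eq_fun do rewrite ReD; exact: measurable_funD.
under eq_fun do rewrite ImD; exact: measurable_funD.
Qed.

Lemma cmeasurable_real u : rmeasurable u -> cmeasurable (fun s => (u s)%:C%C).
Proof. by move=> um; split => //=; exact: measurable_cst. Qed.

Lemma cmeasurable_cst (c : R[i]) : cmeasurable (fun _ : G => c).
Proof. by split; exact: measurable_cst. Qed.

Lemma cmeasurable_subl (t : G) f : cmeasurable f -> cmeasurable (fun s => f (t - s)).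
Proof. by move=> [fr fi]; split; [exact: rmeasurable_subl fr|exact: rmeasurable_subl fi]. Qed.

Lemma cmeasurable_ccvg (f_ : nat -> G -> R[i]) f : (forall n, cmeasurable (f_ n)) ->
  (forall s, ccvg (f_^~ s) (f s)) -> cmeasurable f.
Proof.
move=> mf fc; split.
  apply: (measurable_fun_cvg (h := fun n (s : borel G) => complex.Re (f_ n s))).
    by move=> n; have [] := mf n.
  by move=> s _; have [] := fc s.
apply: (measurable_fun_cvg (h := fun n (s : borel G) => complex.Im (f_ n s))).
  by move=> n; have [] := mf n.
by move=> s _; have [] := fc s.
Qed.

Definition cintegrable f := cmeasurable f /\ (nint (fun s => normc (f s)) < +oo)%E.

Lemma cintegrable_le f u : cmeasurable f -> rmeasurable u ->
  (forall s, normc (f s) <= u s) -> (nint u < +oo)%E -> cintegrable f.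
Proof.
move=> mf um fu ufin; split => //; apply: le_lt_trans ufin.
by apply: nint_le => //; [exact: cmeasurable_normc|move=> s; exact: normc_ge0].
Qed.

Lemma cintegrable_Re f : cintegrable f ->
  mu.-integrable [set: borel G] (fun s => (complex.Re (f s))%:E).
Proof.
move=> [mf fi]; apply: nint_integrable; first by case: mf.
apply: le_lt_trans fi; apply: nint_le => //.
- by apply: (measurableT_comp (@normr_measurable R setT)); case: mf.
- exact: cmeasurable_normc.
- by move=> s; exact: ler_Re_normc.
Qed.

Lemma cintegrable_Im f : cintegrable f ->
  mu.-integrable [set: borel G] (fun s => (complex.Im (f s))%:E).
Proof.
move=> [mf fi]; apply: nint_integrable; first by case: mf.
apply: le_lt_trans fi; apply: nint_le => //.
- by apply: (measurableT_comp (@normr_measurable R setT)); case: mf.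
- exact: cmeasurable_normc.
- by move=> s; exact: ler_Im_normc.
Qed.

Lemma cintegralD f g : cintegrable f -> cintegrable g ->
  cintegral mu (fun s => f s + g s) = cintegral mu f + cintegral mu g.
Proof.
move=> fi gi; rewrite /cintegral; congr Complex.
  under eq_Rintegral do rewrite ReD.
  by rewrite RintegralD//; exact: cintegrable_Re.
under eq_Rintegral do rewrite ImD.
by rewrite RintegralD//; exact: cintegrable_Im.
Qed.

Lemma cintegralZ (c : R[i]) f : cintegrable f ->
  cintegral mu (fun s => c * f s) = c * cintegral mu f.
Proof.
move=> fi; have fr := cintegrable_Re fi; have fj := cintegrable_Im fi.
have fZ (a : R) (u : borel G -> R) : mu.-integrable [set: borel G] (EFin \o u) ->
    mu.-integrable [set: borel G] (fun s => (a * u s)%:E).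
  by move=> ui; under eq_fun do rewrite EFinM; exact: integrableZl.
case: c => a b; rewrite /cintegral; congr Complex.
  under eq_Rintegral do rewrite ReM /=.
  rewrite RintegralB//; [|exact: fZ..].
  by rewrite !RintegralZl.
under eq_Rintegral do rewrite ImM /=.
rewrite RintegralD//; [|exact: fZ..].
by rewrite !RintegralZl.
Qed.

Lemma cintegrableD f g : cintegrable f -> cintegrable g ->
  cintegrable (fun s => f s + g s).
Proof.
move=> [mf fi] [mg gi].
apply: (@cintegrable_le _ (fun s => normc (f s) + normc (g s))).
- exact: cmeasurableD.
- by apply: rmeasurableD; exact: cmeasurable_normc.
- by move=> s; exact: le_normcD.
- rewrite nintD; try exact: cmeasurable_normc.
  + exact: lte_add_pinfty.
  + by move=> s; exact: normc_ge0.
  + by move=> s; exact: normc_ge0.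
Qed.

(** The factor 2 comes from bounding the two coordinates separately; every use is
indifferent to constants. *)
Lemma normc_cintegral_le f (M : R) : cmeasurable f ->
  (nint (fun s => normc (f s)) <= M%:E)%E -> normc (cintegral mu f) <= 2 * M.
Proof.
move=> mf fM; have fi : cintegrable f by split => //; apply: le_lt_trans fM _; rewrite ltry.
have H (u : borel G -> R) : rmeasurable u -> (forall s, `|u s| <= normc (f s)) ->
    mu.-integrable [set: borel G] (EFin \o u) ->
    `|\int[mu]_(s in [set: borel G]) u s| <= M.
  move=> um uf ui; apply: le_trans (le_normr_Rintegral measurableT ui) _.
  rewrite -lee_fin fineK; last by apply: integrable_fin_num => //; exact: integrable_norm.
  apply: le_trans fM; apply: nint_le => //.
  - exact: (measurableT_comp (@normr_measurable R setT)).
  - exact: cmeasurable_normc.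
apply: le_trans (ler_normc_ReIm _) _; rewrite mulr_natl mulr2n lerD// /cintegral /=.
  by apply: H; [case: mf|move=> s; exact: ler_Re_normc|exact: cintegrable_Re].
by apply: H; [case: mf|move=> s; exact: ler_Im_normc|exact: cintegrable_Im].
Qed.

Lemma cintegral_dominated (f_ : nat -> G -> R[i]) f u :
  (forall n, cmeasurable (f_ n)) -> (forall s, ccvg (f_^~ s) (f s)) ->
  rmeasurable u -> (nint u < +oo)%E -> (forall n s, normc (f_ n s) <= u s) ->
  ccvg (fun n => cintegral mu (f_ n)) (cintegral mu f).
Proof.
move=> mf fc um ufin fu.
have u0 s : 0 <= u s by apply: le_trans (fu 0%N s); exact: normc_ge0.
have ui : mu.-integrable [set: borel G] (fun s => (u s)%:E).
  apply: nint_integrable => //; rewrite (_ : (fun s => `|u s|) = u)//.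
  by apply/funext => s; rewrite ger0_norm.
have H (p : R[i] -> R) : (forall n, rmeasurable (fun s => p (f_ n s))) ->
    (forall s, p (f_ n s) @[n --> \oo] --> p (f s)) ->
    (forall z, `|p z| <= normc z) ->
    \int[mu]_(s in [set: borel G]) p (f_ n s) @[n --> \oo] -->
    \int[mu]_(s in [set: borel G]) p (f s).
  move=> mp cp pn.
  have cpE s : (p (f_ n s))%:E @[n --> \oo] --> (p (f s))%:E.
    by apply: cvg_EFin; [exact: nearW|exact: cp].
  have [|||||pi _ pcv] := @dominated_convergence _ (borel G) R mu setT measurableT
      (fun n s => (p (f_ n s))%:E) (fun s => (p (f s))%:E) (fun s => (u s)%:E).
  - by move=> n; apply: rmeasurableE; exact: mp.
  - apply: rmeasurableE.
    by apply: (measurable_fun_cvg (h := fun n (s : borel G) => p (f_ n s))) => // s _.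
  - by apply: aeW => s _; exact: cpE.
  - exact: ui.
  - by apply: aeW => s n _; rewrite lee_fin; exact: le_trans (pn _) (fu n s).
  apply: fine_cvg; rewrite fineK//; exact: integrable_fin_num.
split; apply: H => [n|s|z].
- by case: (mf n).
- by case: (fc s).
- exact: ler_Re_normc.
- by case: (mf n).
- by case: (fc s).
- exact: ler_Im_normc.
Qed.

Lemma cintegral_real u : rmeasurable u ->
  cintegral mu (fun s => (u s)%:C%C) = (fine (nint u))%:C%C.
Proof.
move=> um; rewrite /cintegral /=; congr Complex.
by rewrite /Rintegral integral0.
Qed.

Lemma cintegrableZ (c : R[i]) f : cintegrable f -> cintegrable (fun s => c * f s).
Proof.
move=> [mf fi].
apply: (@cintegrable_le _ (fun s => normc c * normc (f s))).
- by apply: cmeasurableM => //; exact: cmeasurable_cst.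
- by apply: rmeasurableM; [exact: rmeasurable_cst|exact: cmeasurable_normc].
- by move=> s; rewrite normcM.
- rewrite nintZ; [|exact: normc_ge0|exact: cmeasurable_normc|by move=> s; exact: normc_ge0].
  by rewrite lte_mul_pinfty// lee_fin normc_ge0.
Qed.

Lemma nint_eq0 u v : rmeasurable u -> rmeasurable v ->
  (forall s, 0 <= u s) -> (forall s, 0 <= v s) ->
  (forall s, u s = 0 -> v s = 0) -> nint u = 0%E -> nint v = 0%E.
Proof.
move=> um mv u0 v0 uv.
have E w : (forall s, 0 <= w s) ->
    nint w = (\int[mu]_(s in [set: borel G]) `|(w s)%:E|)%E.
  by move=> w0; apply: eq_integral => s _; rewrite gee0_abs// lee_fin.
rewrite !E// => /(ae_eq_integral_abs mu measurableT (rmeasurableE um)) ae0.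
apply/(ae_eq_integral_abs mu measurableT (rmeasurableE mv)).
by apply: filterS ae0 => s /= us _; rewrite uv//; have [] := us I.
Qed.

Lemma nint_gt0 u (B : set G) : rmeasurable u -> (forall s, 0 <= u s) ->
  measurable (B : set (borel G)) -> (0 < mu B)%E -> (forall s, B s -> 0 < u s) ->
  (0 < nint u)%E.
Proof.
move=> um u0 mB B0 Bu; rewrite lt0e nint_ge0// andbT; apply/eqP => u_eq0.
have : nint (\1_B : G -> R) = 0%E.
  apply: (nint_eq0 um _ u0 _ _ u_eq0).
  - exact: rmeasurable_indic.
  - by move=> s; rewrite indicE.
  - move=> s us; rewrite indicE; have [|//] := boolP (s \in B).
    by rewrite inE => /Bu; rewrite us ltxx.
by rewrite /nint integral_indic// setIT => B_eq0; rewrite B_eq0 ltxx in B0.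
Qed.

Hypothesis hG : hausdorff_space G.
Hypothesis lcG : locally_compact [set: G].
Hypothesis hmu : haar_measure mu.

Lemma nint_subl (t : G) u : rmeasurable u -> (forall s, 0 <= u s) ->
  nint (fun s => u (t - s)) = nint u.
Proof.
move=> um u0.
by apply: (haar_ge0_integral_subl hG lcG hmu t (rmeasurableE um)) => s; rewrite lee_fin.
Qed.

Lemma cintegral_subl (t : G) f : cmeasurable f ->
  cintegral mu (fun s => f (t - s)) = cintegral mu f.
Proof.
move=> [fr fi]; rewrite /cintegral /Rintegral; congr (Complex (fine _) (fine _)).
  exact: (haar_integral_subl hG lcG hmu t (rmeasurableE fr)).
exact: (haar_integral_subl hG lcG hmu t (rmeasurableE fi)).
Qed.

End ComplexIntegral.

(** * The Orlicz norm and the modular *)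

Section OrliczModular.
Context {R : realType} {G : topologicalZmodType}.
Variable mu : {measure set (borel G) -> \bar R}.
Variables Phi Psi : R -> \bar R.
Hypotheses (pair : complementary_pair Phi Psi)
  (ciPhi : continuous_increasing Phi) (ciPsi : continuous_increasing Psi).
Let yPhi : young_function Phi. Proof. by case: pair. Qed.
Let yPsi : young_function Psi. Proof. by case: pair. Qed.
Local Notation phi := (yfun Phi).
Local Notation psi := (yfun Psi).
Implicit Types (f g : G -> R[i]) (u v : G -> R).

Lemma rmeasurable_yfun (Y : R -> \bar R) u : young_function Y ->
  continuous_increasing Y -> rmeasurable u -> rmeasurable (fun s => yfun Y (u s)).
Proof. by move=> yY cY um; apply: rmeasurable_comp => //; exact: measurable_yfun cY.2. Qed.

Lemma orlicz_modularE (Y : R -> \bar R) (a : R) f : young_function Y ->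
  continuous_increasing Y -> 0 <= a ->
  (\int[mu]_(s in [set: borel G]) Y (a * normc (f s))%R =
   nint mu (fun s => yfun Y (a * normc (f s))%R))%E.
Proof.
move=> yY cY a0; apply: eq_integral => s _.
by rewrite (yfunE yY cY.2)// mulr_ge0// normc_ge0.
Qed.

Lemma orlicz_spaceP f : orlicz_space mu Phi f <-> cmeasurable f /\
  exists2 a : R, 0 < a & (nint mu (fun s => phi (a * normc (f s))%R) < +oo)%E.
Proof.
by split=> -[mf [a a0 fa]]; split => //; exists a => //; move: fa;
  rewrite orlicz_modularE// ltW.
Qed.

Lemma rmeasurable_modular (a : R) f : cmeasurable f ->
  rmeasurable (fun s => phi (a * normc (f s))).
Proof.
move=> mf; apply: rmeasurable_yfun => //.
by apply: rmeasurableM; [exact: rmeasurable_cst|exact: cmeasurable_normc].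
Qed.

Lemma orlicz_space_le f g (C : R) : orlicz_space mu Phi f -> cmeasurable g ->
  0 <= C -> (forall s, normc (g s) <= C * normc (f s)) -> orlicz_space mu Phi g.
Proof.
move=> /orlicz_spaceP[mf [a a0 fa]] mg C0 gf; apply/orlicz_spaceP; split => //.
have C1 : 0 < C + 1 by rewrite ltr_wpDl.
exists (a / (C + 1)); first by rewrite divr_gt0.
apply: le_lt_trans fa; apply: nint_le; [exact: rmeasurable_modular..| |].
  by move=> s; exact: (yfun_ge0 yPhi ciPhi.2).
move=> s; apply: (yfun_mono yPhi ciPhi.2); rewrite mulrAC ler_pdivrMr// -mulrA.
rewrite ler_wpM2l ?(ltW a0)//; apply: le_trans (gf s) _.
rewrite mulrC ler_wpM2l ?normc_ge0//; lra.
Qed.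

Lemma orlicz_norm_ge f v : rmeasurable v -> (forall s, 0 <= v s) ->
  (nint mu (fun s => psi (v s)) <= 1)%E ->
  (nint mu (fun s => normc (f s) * v s)%R <= orlicz_norm mu Phi f)%E.
Proof.
move=> mv v0 v1; apply: ereal_sup_ubound; exists (fun s => (v s)%:C%C).
  split; first exact: cmeasurable_real.
  apply: le_trans v1; rewrite le_eqVlt; apply/predU1P; left.
  apply: eq_integral => s _; have [_ _ <-] := pair; last exact: normc_ge0.
  by rewrite normc_real ger0_norm// (yfunE yPsi ciPsi.2).
by apply: eq_integral => s _; rewrite normcM normc_real ger0_norm.
Qed.

Lemma orlicz_norm_lty f : orlicz_space mu Phi f -> (orlicz_norm mu Phi f < +oo)%E.
Proof.
move=> /orlicz_spaceP[mf [a a0 fa]].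
set I := nint _ _ in fa.
have I0 : (0 <= I)%E by apply: nint_ge0 => s; exact: (yfun_ge0 yPhi ciPhi.2).
apply: (@le_lt_trans _ _ (a^-1%:E * (I + 1))%E); last first.
  by rewrite lte_mul_pinfty ?lee_fin ?invr_ge0 ?(ltW a0)// lte_add_pinfty// ltry.
apply: ge_ereal_sup => _ [v [mv v1] <-].
have mpv : rmeasurable (fun s => psi (normc (v s))).
  by apply: rmeasurable_yfun => //; exact: cmeasurable_normc.
have {}v1 : (nint mu (fun s => psi (normc (v s))) <= 1)%E.
  apply: le_trans v1; rewrite le_eqVlt; apply/predU1P; left.
  apply: eq_integral => s _; have [_ _ <-] := pair; last exact: normc_ge0.
  by rewrite (yfunE yPsi ciPsi.2)// normc_ge0.
apply: (@le_trans _ _ (nint mu (fun s =>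
    a^-1 * (phi (a * normc (f s)) + psi (normc (v s)))))).
  apply: nint_le.
  - by apply: cmeasurable_normc; exact: cmeasurableM.
  - apply: rmeasurableM; first exact: rmeasurable_cst.
    by apply: rmeasurableD => //; exact: rmeasurable_modular.
  - by move=> s; exact: normc_ge0.
  - move=> s; rewrite normcM -ler_pdivrMl ?invr_gt0// invrK mulrA.
    by apply: (young_ineq pair ciPhi ciPsi); rewrite ?mulr_ge0 ?normc_ge0 ?(ltW a0).
have p0 s := yfun_ge0 yPhi ciPhi.2 (a * normc (f s)).
have q0 s := yfun_ge0 yPsi ciPsi.2 (normc (v s)).
have mp := rmeasurable_modular a mf.
rewrite nintZ ?invr_ge0 ?(ltW a0)//; last 2 first.
- exact: rmeasurableD.
- by move=> s; rewrite addr_ge0.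
by rewrite nintD// lee_wpmul2l ?lee_fin ?invr_ge0 ?(ltW a0)// leeD2l.
Qed.

(** Test the norm on [v = J^-1 * phi u / u], where [J] is the modular of [u].
If [J > 1], then [psi v <= J^-1 * phi u] by convexity and [young_conj_slope], so
that [v] is admissible; but the integral of [u * v] is [J^-1 * J = 1], which
exceeds the norm. *)
Lemma modular_truncated_le1 f (u : G -> R) : rmeasurable u ->
  (forall s, u s = 0 \/ (0 < u s /\ u s = normc (f s))) ->
  (nint mu (fun s => phi (u s)) < +oo)%E ->
  (orlicz_norm mu Phi f < 1)%E -> (nint mu (fun s => phi (u s)) <= 1)%E.
Proof.
move=> um uf u_fin f1; rewrite leNgt; apply/negP => J1.
pose J := fine (nint mu (fun s => phi (u s))).
have u0 s : 0 <= u s by case: (uf s) => [->//|[/ltW]].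
have mpu : rmeasurable (fun s => phi (u s)) by exact: rmeasurable_yfun.
have p0 s : 0 <= phi (u s) := yfun_ge0 yPhi ciPhi.2 (u s).
have JE : nint mu (fun s => phi (u s)) = J%:E.
  by rewrite /J fineK// ge0_fin_numE//; exact: nint_ge0.
have {}J1 : 1 < J by rewrite -lte_fin -JE.
have J0 : 0 < J by exact: lt_trans J1.
pose v s := J^-1 * (phi (u s) * (u s)^-1).
have v0 s : 0 <= v s by rewrite mulr_ge0 ?invr_ge0 ?(ltW J0)// mulr_ge0 ?invr_ge0.
have mslope : measurable_fun [set: R] (fun x => phi x / x).
  by apply: nondecreasing_measurable => //; exact: (yfun_slope_mono yPhi ciPhi.2).
have mv : rmeasurable v.
  apply: rmeasurableM; first exact: rmeasurable_cst.
  exact: (rmeasurable_comp mslope).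
have Jinv : 0 <= J^-1 <= 1.
  by rewrite invr_ge0 (ltW J0) invf_le1// ltW.
have psiv s : psi (v s) <= J^-1 * phi (u s).
  have w0 : 0 <= phi (u s) * (u s)^-1 by rewrite mulr_ge0// invr_ge0.
  apply: le_trans (yfun_convex0 yPsi ciPsi.2 Jinv w0) _.
  rewrite ler_wpM2l ?invr_ge0 ?(ltW J0)//.
  case: (uf s) => [->|[us _]]; last exact: (young_conj_slope pair ciPhi ciPsi).
  by rewrite invr0 mulr0 !yfun0.
have v1 : (nint mu (fun s => psi (v s)) <= 1)%E.
  apply: (@le_trans _ _ (nint mu (fun s => J^-1 * phi (u s)))).
    apply: nint_le => //; first exact: rmeasurable_yfun.
    - by apply: rmeasurableM => //; exact: rmeasurable_cst.
    - by move=> s; exact: (yfun_ge0 yPsi ciPsi.2).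
  rewrite nintZ ?invr_ge0 ?(ltW J0)// JE -EFinM mulVf ?gt_eqF//.
have := le_lt_trans (orlicz_norm_ge f mv v0 v1) f1.
suff -> : nint mu (fun s => normc (f s) * v s) = 1%E by rewrite ltxx.
transitivity (nint mu (fun s => J^-1 * phi (u s))).
  apply: eq_integral => s _; congr (_%:E); rewrite /v.
  case: (uf s) => [->|[us <-]]; first by rewrite invr0 !mulr0 yfun0// mulr0.
  by field; rewrite !gt_eqF.
by rewrite nintZ ?invr_ge0 ?(ltW J0)// JE -EFinM mulVf ?gt_eqF.
Qed.

(** The truncations [u n] of [normc f] to values between [1 / (n + 1)] and [n + 1]
have a finite modular, because on that range [phi] is at most a constant times
[phi (a * _)], which is integrable along [f] for some [a > 0]; the bound for
[u n] passes to the limit by monotone convergence. *)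
Lemma modular_le1 f : orlicz_space mu Phi f -> (orlicz_norm mu Phi f < 1)%E ->
  (nint mu (fun s => phi (normc (f s))) <= 1)%E.
Proof.
move=> /orlicz_spaceP[mf [a a0 fa]] f1.
have mn := cmeasurable_normc mf.
pose A n : set (borel G) := [set s | n.+1%:R^-1 <= normc (f s) <= n.+1%:R].
have mA n : measurable (A n).
  rewrite (_ : A n = (fun s : borel G => normc (f s)) @^-1` `[n.+1%:R^-1, n.+1%:R]%classic).
    by rewrite -[X in measurable X]setTI; apply: mn => //; exact: measurable_itv.
  by apply/seteqP; split=> s /=; rewrite in_itv.
pose u n s := normc (f s) * \1_(A n) s.
have um n : rmeasurable (u n).
  by apply: rmeasurableM => //; exact: rmeasurable_indic.
have uf n s : u n s = 0 \/ (0 < u n s /\ u n s = normc (f s)).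
  rewrite /u indicE; have [sA|] := boolP (s \in A n); last by rewrite mulr0; left.
  rewrite mulr1; right; split => //; move: sA; rewrite inE => /andP[+ _].
  by apply: lt_le_trans; rewrite invr_gt0 ltr0n.
have u0 n s : 0 <= u n s by rewrite mulr_ge0 ?normc_ge0// indicE.
have p0 := yfun_ge0 yPhi ciPhi.2.
have mpu n : rmeasurable (fun s => phi (u n s)) by exact: rmeasurable_yfun.
have u_fin n : (nint mu (fun s => phi (u n s)) < +oo)%E.
  have pa : 0 < phi (a / n.+1%:R).
    by apply: (yfun_gt0 yPhi ciPhi.2); rewrite divr_gt0.
  pose c := phi n.+1%:R / phi (a / n.+1%:R).
  have c0 : 0 <= c by rewrite divr_ge0.
  apply: (@le_lt_trans _ _ (nint mu (fun s => c * phi (a * normc (f s))))).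
    apply: nint_le => //.
      by apply: rmeasurableM; [exact: rmeasurable_cst|exact: rmeasurable_modular].
    move=> s; rewrite /u indicE; have [sA|] := boolP (s \in A n); last first.
      by rewrite mulr0 yfun0// mulr_ge0.
    rewrite mulr1; move: sA; rewrite inE => /andP[sl su].
    rewrite /c mulrAC ler_pdivlMr// ler_pM//.
      exact: (yfun_mono yPhi ciPhi.2).
    apply: (yfun_mono yPhi ciPhi.2); rewrite ler_wpM2l ?(ltW a0)//.
  rewrite nintZ//; last exact: rmeasurable_modular.
  by rewrite lte_mul_pinfty// lee_fin.
have u1 n := modular_truncated_le1 (um n) (uf n) (u_fin n) f1.
have nd s : nondecreasing_seq (fun n => (phi (u n s))%:E).
  move=> n m nm; rewrite lee_fin; apply: (yfun_mono yPhi ciPhi.2).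
  rewrite /u ler_wpM2l ?normc_ge0// !indicE.
  have [|] := boolP (s \in A n); last by rewrite ler0n.
  rewrite inE => /andP[sl su]; rewrite mem_set//; apply/andP; split.
    by apply: le_trans sl; rewrite lef_pV2 ?posrE ?ltr0n// ler_nat.
  by apply: le_trans su _; rewrite ler_nat.
have cv s : (phi (u n s))%:E @[n --> \oo] --> (phi (normc (f s)))%:E.
  have [s0|s0] := eqVneq (normc (f s)) 0.
    by rewrite /u s0; under eq_fun do rewrite mul0r; exact: cvg_cst.
  have {}s0 : 0 < normc (f s) by rewrite lt0r s0 normc_ge0.
  pose N := maxn (Num.bound (normc (f s))) (Num.bound (normc (f s))^-1).
  apply: (@cvg_near_cst _ _ _ _ \oo) => //; exists N => // n /= Nn.
  rewrite /u indicE mem_set ?mulr1//.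
  have H x : 0 <= x -> (Num.bound x <= n)%N -> x <= n.+1%:R.
    move=> x0 xn; apply: le_trans (ltW (archi_boundP x0)) _.
    by rewrite ler_nat (leq_trans xn).
  apply/andP; split; last first.
    by apply: H; [exact: ltW|exact: leq_trans (leq_maxl _ _) Nn].
  rewrite -[leRHS]invrK lef_pV2 ?posrE ?invr_gt0 ?ltr0n//.
  by apply: H; [rewrite invr_ge0 ltW|exact: leq_trans (leq_maxr _ _) Nn].
have := @cvg_monotone_convergence _ (borel G) R mu setT measurableT
  (fun n s => (phi (u n s))%:E) (fun n => rmeasurableE (mpu n)).
move=> /(_ (fun n s _ => p0 _) (fun s _ => nd s)) cvi.
rewrite /nint (_ : (\int[mu]_(s in _) _)%E =
    (\int[mu]_(s in [set: borel G]) limn (fun n => (phi (u n s))%:E))%E); last first.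
  by apply: eq_integral => s _; apply/esym/cvg_lim => //; exact: cv.
rewrite -(cvg_lim _ cvi)//; apply: lime_le; first by apply/cvg_ex; eexists; exact: cvi.
by apply: nearW => n; exact: u1.
Qed.

End OrliczModular.

(** * Word length *)

Section WordLength.
Context {G : zmodType}.
Variable U : set G.
Implicit Types s t u : G.

Lemma sumset0 s : sumset U 0 s <-> s = 0.
Proof.
split=> [[u _ ->]|->]; first by rewrite big_ord0.
by exists (fun=> 0); [case|rewrite big_ord0].
Qed.

Lemma sumsetS n s : sumset U n.+1 s <-> exists2 t, sumset U n t & U (s - t).
Proof.
split=> [[u Uu ->]|[t [u Uu ->] Ust]].
  exists (\sum_(i < n) u (widen_ord (leqnSn n) i)).
    by exists (fun i => u (widen_ord (leqnSn n) i)).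
  by rewrite big_ord_recr/= addrAC subrr add0r.
exists (fun i : 'I_n.+1 => if unlift ord_max i is Some j then u j
    else s - \sum_(i < n) u i).
  by move=> i; case: unliftP => [j _|_].
rewrite big_ord_recr/= unlift_none (eq_bigr u); first by rewrite addrC subrK.
move=> i _.
case: unliftP => [j /(congr1 val)|/(congr1 val)] /=.
  by rewrite /bump leqNgt ltn_ord add0n => /val_inj ->.
by move=> /eqP; rewrite ltn_eqF// ltn_ord.
Qed.

Lemma sumset1 s : U s -> sumset U 1 s.
Proof. by move=> Us; apply/sumsetS; exists 0; [exact/sumset0|rewrite subr0]. Qed.

Lemma sumsetD m n s t : sumset U m s -> sumset U n t -> sumset U (m + n) (s + t).
Proof.
move=> ms; elim: n t => [|n ih] t; first by move=> /sumset0 ->; rewrite addn0 addr0.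
move=> /sumsetS[t' nt' Ut]; rewrite addnS; apply/sumsetS; exists (s + t'); first exact: ih.
by rewrite opprD addrACA subrr add0r.
Qed.

Hypothesis U0 : U 0.

Lemma sumset_le m n s : (m <= n)%N -> sumset U m s -> sumset U n s.
Proof.
move=> /subnKC <- ms; rewrite -[s]addr0; apply: sumsetD => //.
elim: (n - m)%N => [|k ih]; first exact/sumset0.
by apply/sumsetS; exists 0 => //; rewrite subr0.
Qed.

Hypothesis Ugen : forall s, exists n, sumset U n s.

Lemma word_length_le n s : sumset U n s -> (word_length U s <= n)%N.
Proof.
rewrite /word_length; have [//|s0 ns] := eqVneq s 0.
case: pselect => // h; case: ex_minnP => m _; apply; apply/asboolP; split => //.
by case: n ns => // /sumset0 s_eq0; rewrite s_eq0 eqxx in s0.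
Qed.

Lemma sumset_word_length s : sumset U (word_length U s) s.
Proof.
rewrite /word_length; have [->|s0] := eqVneq s 0; first exact/sumset0.
case: pselect => [h|[]]; first by case: ex_minnP => m /asboolP[].
have [n ns] := Ugen s; exists n.+1; apply/asboolP; split => //.
exact: sumset_le ns.
Qed.

Lemma word_length_leP n s : (word_length U s <= n)%N <-> sumset U n s.
Proof.
split; last exact: word_length_le.
by move=> sn; exact: sumset_le (sumset_word_length s).
Qed.

Lemma word_lengthD s t :
  (word_length U (s + t) <= word_length U s + word_length U t)%N.
Proof. by apply: word_length_le; apply: sumsetD; exact: sumset_word_length. Qed.

Hypothesis Usym : forall s, U s -> U (- s).

Lemma word_lengthN s : (word_length U (- s) <= word_length U s)%N.
Proof.
apply: word_length_le; have [u Uu sE] := sumset_word_length s.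
exists (fun i => - u i); first by move=> i; exact: Usym.
by rewrite {1}sE -sumrN.
Qed.

Lemma word_lengthB s t :
  (word_length U s <= word_length U t + word_length U (t - s))%N.
Proof.
rewrite -{1}[s](subKr t); apply: leq_trans (word_lengthD _ _) _.
by rewrite leq_add2l; exact: word_lengthN.
Qed.

Lemma additive_le_word_length (R : realType) (chi : G -> R) :
  (forall s t, chi (s + t) = chi s + chi t) ->
  (forall s, U s -> `|chi s| <= 1) -> forall s, `|chi s| <= (word_length U s)%:R.
Proof.
move=> chiD chi1 s.
have chi0 : chi 0 = 0 by apply: (addrI (chi 0)); rewrite -chiD !addr0.
have H n t : sumset U n t -> `|chi t| <= n%:R.
  elim: n t => [|n ih] t; first by move=> /sumset0 ->; rewrite chi0 normr0.
  move=> /sumsetS[t' /ih nt' /chi1 Ut].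
  rewrite -(subrK t' t) chiD -natr1 addrC; apply: le_trans (ler_normD _ _) _.
  exact: lerD.
exact: H (sumset_word_length s).
Qed.

End WordLength.

Section WordLengthTopology.
Context {R : realType} {G : topologicalZmodType}.
Variables (mu : {measure set (borel G) -> \bar R}) (U : set G).
Hypotheses (hG : hausdorff_space G) (hmu : haar_measure mu).
Hypotheses (oU : open U) (U0 : U 0) (Ugen : forall s, exists n, sumset U n s).

Lemma open_sumset n : open (sumset U n.+1).
Proof.
rewrite (_ : sumset U n.+1 = \bigcup_(t in sumset U n) [set s | U (s - t)]).
  by apply: bigcup_open => t _; exact: open_subr.
by apply/seteqP; split=> [s /sumsetS[t nt Ust]|s [t nt /= Ust]];
  [exists t|apply/sumsetS; exists t].
Qed.

Lemma measurable_sumset n : measurable (sumset U n : set (borel G)).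
Proof.
case: n => [|n]; last by apply: open_borel; exact: open_sumset.
rewrite (_ : sumset U 0 = [set 0]); first by apply: compact_borel => //; exact: compact_set1.
by apply/seteqP; split=> s /sumset0.
Qed.

(** The word length takes countably many values and its sublevel sets are the
sumsets of [U]. *)
Lemma rmeasurable_word_length (h : nat -> R) :
  rmeasurable (fun s : G => h (word_length U s)).
Proof.
move=> _ Y mY; rewrite setTI.
rewrite (_ : _ @^-1` _ = \bigcup_n [set s : borel G | word_length U s = n /\ Y (h n)]).
  apply: bigcup_measurable => n _.
  have [hY|hY] := pselect (Y (h n)); last first.
    rewrite (_ : [set _ | _] = set0)//; apply/seteqP; split=> s //= [_].
    exact: hY.
  have H k : measurable ([set s : borel G | (word_length U s <= k)%N] : set (borel G)).
    rewrite (_ : [set _ | _] = sumset U k); first exact: measurable_sumset.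
    by apply/seteqP; split=> s /(word_length_leP U0 Ugen).
  case: n hY => [|n] hY.
    rewrite (_ : [set _ | _] = [set s : borel G | (word_length U s <= 0)%N]) //.
    apply/seteqP; split=> s /=; first by move=> [-> _].
    by rewrite leqn0 => /eqP ->.
  rewrite (_ : [set _ | _] = [set s : borel G | (word_length U s <= n.+1)%N] `\`
    [set s : borel G | (word_length U s <= n)%N]).
    exact: measurableD.
  apply/seteqP; split=> s /=; first by move=> [-> _]; rewrite leqnn ltnn.
  by move=> [sn /negP]; rewrite -ltnNge => ns; split => //; apply/eqP; rewrite eqn_leq sn.
by apply/seteqP; split=> [s Ys|s [n _ [<-]]//]; exists (word_length U s).
Qed.

(** The translates of [W] by the multiples of [e] lie in disjoint bands of values of
[chi], so that word balls grow at least linearly. *)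
Lemma haar_sumset_ge (chi : G -> R) (e : G) : continuous chi ->
  (forall s t, chi (s + t) = chi s + chi t) -> U e -> 0 < chi e ->
  exists2 c : R, 0 < c & forall n, ((n%:R * c)%:E <= mu (sumset U n))%E.
Proof.
move=> cchi chiD Ue chie.
have chi0 : chi 0 = 0 by apply: (addrI (chi 0)); rewrite -chiD !addr0.
pose W : set G := U `&` [set s | `|chi s| < chi e / 2].
have oW : open W.
  apply: openI => //; rewrite (_ : [set _ | _] = chi @^-1` ball (0 : R) (chi e / 2)).
    by apply: open_comp => [s _|]; [exact: cchi|exact: ball_open; rewrite divr_gt0].
  by apply/seteqP; split=> s; rewrite /ball/= sub0r normrN.
have W0 : W 0 by split => //=; rewrite chi0 normr0 divr_gt0.
have muW : (0 < mu W)%E by apply: (haar_open_gt0 hG hmu oW); exists 0.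
have [c c0 cW] : exists2 c : R, 0 < c & (c%:E <= mu W)%E.
  move: muW; case: (mu W) => [r r0|_|//]; first by exists r.
  by exists 1 => //; rewrite leey.
exists c => // n.
have mW : measurable (W : set (borel G)) by exact: open_borel.
pose F j : set (borel G) := [set s | W (s - e *+ j)].
have mF j : measurable (F j) by exact: measurable_subr.
have chiM j : chi (e *+ j) = j%:R * chi e.
  elim: j => [|j ih]; first by rewrite mulr0n chi0 mul0r.
  by rewrite mulrS chiD ih -natr1; ring.
have chiN j s : chi (s - e *+ j) = chi s - j%:R * chi e.
  by have := chiD (s - e *+ j) (e *+ j); rewrite subrK chiM => ->; rewrite addrK.
have tF : trivIset setT F.
  move=> i j _ _ [s [[_ /= si] [_ /= sj]]]; move: si sj; rewrite !chiN.
  rewrite !ltr_distl => /andP[i1 i2] /andP[j1 j2].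
  have [ij|ij|//] := ltngtP i j; exfalso.
    have : i.+1%:R * chi e <= j%:R * chi e by rewrite ler_pM2r// ler_nat.
    by rewrite -natr1; lra.
  have : j.+1%:R * chi e <= i%:R * chi e by rewrite ler_pM2r// ler_nat.
  by rewrite -natr1; lra.
have Fn : \big[setU/set0]_(j < n) F j `<=` sumset U n.
  rewrite -bigcup_mkord => s [j /= jn [Us _]].
  apply: (sumset_le U0 jn); apply/sumsetS; exists (e *+ j) => //.
  elim: j {jn Us} => [|j ih]; first exact/sumset0.
  by apply/sumsetS; exists (e *+ j) => //; rewrite mulrSr addrC addrA addNr add0r.
apply: (@le_trans _ _ (mu (\big[setU/set0]_(j < n) F j))); last first.
  apply: le_measure; rewrite ?inE//; first exact: bigsetU_measurable.
  exact: measurable_sumset.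
rewrite measure_bigsetU//.
elim: n {Fn} => [|n ih]; first by rewrite big_ord0 mul0r.
rewrite big_ord_recr /= -natr1 mulrDl mul1r EFinD leeD//.
by rewrite /F haar_addr.
Qed.

End WordLengthTopology.

(** * The convolution estimate in the weighted space *)

Section WeightedEstimate.
Context {R : realType} {G : topologicalZmodType}.
Variables (mu : {measure set (borel G) -> \bar R}) (U : set G).
Hypotheses (hG : hausdorff_space G) (lcG : locally_compact [set: G])
  (hmu : haar_measure mu).
Hypotheses (oU : open U) (U0 : U 0) (Ugen : forall s, exists n, sumset U n s)
  (Usym : forall s, U s -> U (- s)).
Variables Phi Psi : R -> \bar R.
Hypotheses (pair : complementary_pair Phi Psi)
  (ciPhi : continuous_increasing Phi) (ciPsi : continuous_increasing Psi)
  (yPhi_sqrt : young_function (fun x => Phi (Num.sqrt x))).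
Variables (nu : nat -> R) (omega : G -> R).
Hypotheses (nu_mono : forall p q, (p <= q)%N -> nu p <= nu q)
  (nu_subadd : forall p q, nu (p + q)%N <= nu p + nu q)
  (nu0 : nu 0%N = 0)
  (omegaE : forall t, omega t = expR (nu (word_length U t))).
Hypothesis omega_inv : orlicz_space mu Psi (fun t => ((omega t)^-1)%:C%C).
Hypothesis U_growth : exists2 c : R, 0 < c &
  forall n, ((n%:R * c)%:E <= mu (sumset U n))%E.
Let yPhi : young_function Phi. Proof. by case: pair. Qed.
Let yPsi : young_function Psi. Proof. by case: pair. Qed.
Local Notation phi := (yfun Phi).
Local Notation psi := (yfun Psi).
Local Notation len := (word_length U).
Let phi0 x : 0 <= phi x. Proof. exact: (yfun_ge0 yPhi ciPhi.2). Qed.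
Let psi0 x : 0 <= psi x. Proof. exact: (yfun_ge0 yPsi ciPsi.2). Qed.

Lemma weight_gt0 s : 0 < omega s. Proof. by rewrite omegaE expR_gt0. Qed.

Lemma weight_ge1 s : 1 <= omega s.
Proof. by rewrite omegaE -expR0 ler_expR -nu0 nu_mono. Qed.

Lemma weight_le s t : (len s <= len t)%N -> omega s <= omega t.
Proof. by move=> st; rewrite !omegaE ler_expR nu_mono. Qed.

Lemma weight_sub s t : omega s <= omega t * omega (t - s).
Proof.
rewrite !omegaE -expRD ler_expR; apply: le_trans (nu_subadd _ _).
by apply: nu_mono; exact: word_lengthB.
Qed.

Lemma rmeasurable_weight : rmeasurable omega.
Proof.
rewrite (_ : omega = fun t => expR (nu (len t))); last exact/funext.
exact: (rmeasurable_word_length hG oU U0 Ugen (fun n => expR (nu n))).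
Qed.

Lemma rmeasurable_weightV : rmeasurable (fun s => (omega s)^-1).
Proof.
rewrite (_ : (fun s => _) = fun t => (expR (nu (len t)))^-1); last first.
  by apply/funext => t; rewrite omegaE.
exact: (rmeasurable_word_length hG oU U0 Ugen (fun n => (expR (nu n))^-1)).
Qed.

Lemma weight_integrable : exists2 a : R, 0 < a &
  (nint mu (fun s => psi (a / omega s)%R) < +oo)%E.
Proof.
case: omega_inv => _ [a a0 fa]; exists a => //; move: fa.
rewrite orlicz_modularE ?(ltW a0)//; congr (_ < _)%E.
apply: eq_integral => s _; congr (psi _)%:E.
by rewrite normc_real ger0_norm// invr_ge0 ltW// weight_gt0.
Qed.

Lemma rmeasurable_psi_weight (a : R) : rmeasurable (fun s => psi (a / omega s)).
Proof.
apply: rmeasurable_yfun => //; apply: rmeasurableM; first exact: rmeasurable_cst.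
exact: rmeasurable_weightV.
Qed.

(** The weight is at most [omega s] on the word ball of radius [len s], so the
integral of [psi (a / omega)] is at least [psi (a / omega s)] times the measure
of that ball, which is at least proportional to [len s]. *)
Lemma length_psi_bounded (a : R) : 0 < a ->
  (nint mu (fun s => psi (a / omega s)%R) < +oo)%E ->
  exists2 C : R, 0 <= C & forall s, (1 + (len s)%:R) * psi (a / omega s) <= C.
Proof.
move=> a0 Ifin; have [c c0 cU] := U_growth.
pose I := fine (nint mu (fun s => psi (a / omega s))).
have I0 : (0 <= nint mu (fun s => psi (a / omega s)%R))%E.
  by apply: nint_ge0 => s; exact: psi0.
have IE : nint mu (fun s => psi (a / omega s)) = I%:E.
  by rewrite /I fineK// ge0_fin_numE.
exists (psi a + I / c).
  by rewrite addr_ge0// divr_ge0 ?(ltW c0)// fine_ge0.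
move=> s; rewrite mulrDl mul1r lerD//.
  apply: (yfun_mono yPsi ciPsi.2); rewrite ler_pdivrMr ?weight_gt0//.
  by rewrite ler_peMr ?weight_ge1// ltW.
rewrite ler_pdivlMr//; set y := psi _.
have y0 : 0 <= y by exact: psi0.
rewrite -lee_fin -IE.
apply: (@le_trans _ _ (y%:E * mu (sumset U (len s)))%E).
  rewrite (_ : _ * _ * c = y * ((len s)%:R * c)); last by ring.
  by rewrite EFinM lee_wpmul2l// lee_fin.
have mS := measurable_sumset hG oU (len s).
have -> : (y%:E * mu (sumset U (len s)) =
    nint mu (fun t => y * \1_(sumset U (len s)) t)%R)%E.
  rewrite nintZ//; last exact: (rmeasurable_indic (R := R) mS).
  by rewrite /nint integral_indic// setIT.
apply: nint_le.
- by apply: rmeasurableM; [exact: rmeasurable_cst|exact: (rmeasurable_indic (R := R) mS)].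
- exact: rmeasurable_psi_weight.
- by move=> t; rewrite mulr_ge0// indicE.
- move=> t; rewrite indicE; have [tS|] := boolP (t \in _); last by rewrite mulr0.
  rewrite mulr1; apply: (yfun_mono yPsi ciPsi.2).
  rewrite ler_pM2l// lef_pV2 ?posrE ?weight_gt0//; apply: weight_le.
  by apply: word_length_le; move: tS; rewrite inE.
Qed.

(** With [y = a / omega s], submultiplicativity bounds the left-hand side by a
multiple of [(1 + len s) * y ^+ 2 * (F * H)], and [F * H] is at most the half sum
of the squares; [young_sqr_ineq] turns each square into [psi y * (phi + psi y)],
and [psi y] absorbs the length by [sC]. *)
Lemma weighted_product_le (a C F H : R) s t : 0 < a ->
  (1 + (len s)%:R) * psi (a / omega s) <= C ->
  0 <= F -> 0 <= H ->
  (1 + (len s)%:R) * (F / omega s * (H / omega (t - s))) <=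
  omega t * (2 * C / a ^+ 2) *
    (phi F + phi H + 2 * psi (a / omega s)).
Proof.
move=> a0 sC F0 H0; set y := a / omega s in sC *.
have w := weight_gt0; have y0 : 0 < y by rewrite divr_gt0.
have L0 : 0 <= 1 + (len s)%:R :> R by rewrite addr_ge0.
have sq X : 0 <= X -> (1 + (len s)%:R) * (X ^+ 2 * y ^+ 2) <= 4 * C * (phi X + psi y).
  move=> X0; apply: le_trans (ler_wpM2l L0 (young_sqr_ineq pair ciPhi ciPsi
    yPhi_sqrt X0 (ltW y0))) _.
  rewrite (_ : _ * (4 * _ * _) =
    (1 + (len s)%:R) * psi y * (4 * (phi X + psi y))); last by ring.
  rewrite (_ : 4 * C * _ = C * (4 * (phi X + psi y))); last by ring.
  by rewrite ler_wpM2r// mulr_ge0// addr_ge0.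
have Fs := sq F F0; have Hs := sq H H0.
apply: (@le_trans _ _ ((1 + (len s)%:R) * (F * H) * (omega t * y ^+ 2 / a ^+ 2))).
  rewrite (_ : _ * (_ / _ * _) =
    (1 + (len s)%:R) * (F * H) * ((omega s)^-1 * (omega (t - s))^-1)); last by ring.
  rewrite ler_wpM2l ?mulr_ge0//.
  rewrite (_ : _ / a ^+ 2 = (omega s)^-1 * (omega t / omega s)); last first.
    by rewrite /y; field; rewrite !gt_eqF.
  rewrite ler_wpM2l ?invr_ge0 ?(ltW (w _))//.
  rewrite ler_pdivlMr// mulrC ler_pdivrMr//; exact: weight_sub.
rewrite (_ : _ * (omega t * _ / _) = omega t / a ^+ 2 *
  ((1 + (len s)%:R) * (F * H) * y ^+ 2)); last by ring.
rewrite [X in _ <= X](_ : _ = omega t / a ^+ 2 *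
  (2 * C * (phi F + phi H + 2 * psi y))); last by ring.
rewrite ler_wpM2l ?divr_ge0 ?sqr_ge0 ?(ltW (w _))//.
have FH : F * H <= (F ^+ 2 + H ^+ 2) / 2.
  by have := sqr_ge0 (F - H); rewrite sqrrB; lra.
apply: (@le_trans _ _ ((1 + (len s)%:R) * ((F ^+ 2 + H ^+ 2) / 2) * y ^+ 2)).
  by rewrite ler_wpM2r ?sqr_ge0// ler_wpM2l.
move: Fs Hs; set L := 1 + _; set X := phi F; set Y := phi H; set Z := psi y.
nra.
Qed.

Local Notation A := (weighted_space omega (orlicz_space mu Phi)).
Local Notation nrm := (weighted_norm mu Phi omega).
Local Notation conv := (convolution mu).

Hypothesis BA : banach_algebra A conv nrm.

Lemma normc_weigh (x : G -> R[i]) s : normc (weigh omega x s) = normc (x s) * omega s.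
Proof. by rewrite /weigh normcM normc_real ger0_norm// ltW// weight_gt0. Qed.

Lemma weighted_cmeasurable x : A x -> cmeasurable x.
Proof.
move=> [mx _]; rewrite (_ : x = fun s => weigh omega x s * ((omega s)^-1)%:C%C).
  apply: cmeasurableM => //; apply: cmeasurable_real; exact: rmeasurable_weightV.
apply/funext => s; rewrite /weigh -mulrA -rmorphM/= mulfV ?mulr1//.
by rewrite gt_eqF// weight_gt0.
Qed.

Lemma cmeasurable_weigh x : cmeasurable x -> cmeasurable (weigh omega x).
Proof.
move=> mx; apply: cmeasurableM => //; apply: cmeasurable_real.
exact: rmeasurable_weight.
Qed.

Lemma weighted_space_le x y (C : R) : A x -> cmeasurable y -> 0 <= C ->
  (forall s, normc (y s) <= C * normc (x s)) -> A y.
Proof.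
move=> Ax my C0 yx; apply: (orlicz_space_le pair ciPhi Ax (C := C)) => //.
  exact: cmeasurable_weigh.
by move=> s; rewrite !normc_weigh mulrA ler_wpM2r ?(ltW (weight_gt0 s)).
Qed.

(** Homogeneity of the norm reduces the claim to [modular_le1] for [x / p]. *)
Lemma weighted_modular_le1 x (p : R) : A x -> 0 < p -> nrm x < p ->
  (nint mu (fun s => phi (normc (x s) * omega s / p)%R) <= 1)%E.
Proof.
move=> Ax p0 xp; pose y : G -> R[i] := (p^-1)%:C%C *: x.
have Ay : A y.
  have := ba_linear BA (p^-1)%:C%C Ax (ba_zero BA); by rewrite addr0.
have ny : nrm y < 1.
  rewrite /y (ba_normZ BA)// normc_real ger0_norm ?invr_ge0 ?(ltW p0)//.
  by rewrite mulrC ltr_pdivrMr// mul1r.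
have : (orlicz_norm mu Phi (weigh omega y) < 1)%E.
  rewrite -(@fineK _ (orlicz_norm _ _ _)); first by rewrite lte_fin.
  rewrite fin_numElt (orlicz_norm_lty pair ciPhi ciPsi Ay) andbT.
  apply: (@lt_le_trans _ _ 0%E); first by rewrite ltNyr.
  have := @orlicz_norm_ge R G mu Phi Psi pair ciPsi (weigh omega y) (fun=> 0)
    (rmeasurable_cst 0) (fun=> lexx _).
  have nint0 (h : G -> R) : (forall s, h s = 0) -> nint mu h = 0%E.
    by move=> h0; rewrite /nint (eq_integral (cst 0%E)) ?integral0// => s _; rewrite h0.
  rewrite !nint0//; first by apply.
    by move=> s; rewrite mulr0.
  by move=> s; rewrite (yfun0 yPsi).
move=> /(modular_le1 pair ciPhi ciPsi Ay); congr (_ <= _)%E.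
apply: eq_integral => s _; congr (phi _)%:E.
rewrite normc_weigh /y /= normcM normc_real ger0_norm ?invr_ge0 ?(ltW p0)//.
by rewrite -mulrA mulrC.
Qed.

(** The convolution of [len * x] with [z] converges absolutely at every point, with
a bound that is locally uniform.  For [p] and [q] greater than the norms of [x]
and [z], integrate [weighted_product_le] for [x / p] and [z / q]: the three terms
on the right have integrals at most 1, 1 and twice that of [psi (a / omega)]. *)
Lemma weighted_convolution_bound : exists2 M : R, 0 <= M &
  forall x z, A x -> A z -> forall t,
  (nint mu (fun s => (1 + (len s)%:R) * (normc (x s) * normc (z (t - s)%R)))%R <=
   (omega t * M * (nrm x * nrm z))%:E)%E.
Proof.
have [a a0 Ifin] := weight_integrable.
have [C C0 sC] := length_psi_bounded a0 Ifin.
pose I := fine (nint mu (fun s => psi (a / omega s))).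
have I0' : (0 <= nint mu (fun s => psi (a / omega s)%R))%E.
  by apply: nint_ge0 => s; exact: psi0.
have IE : nint mu (fun s => psi (a / omega s)) = I%:E.
  by rewrite /I fineK// ge0_fin_numE.
have I0 : 0 <= I by rewrite -lee_fin -IE.
pose M := 2 * C / a ^+ 2 * (2 + 2 * I).
have k0 : 0 <= 2 * C / a ^+ 2.
  by apply: divr_ge0; [exact: mulr_ge0|exact: sqr_ge0].
have M0 : 0 <= M by apply: mulr_ge0 => //; apply: addr_ge0 => //; exact: mulr_ge0.
exists M => // x z Ax Az t.
have w0 := weight_gt0.
have mlen : rmeasurable (fun s : G => 1 + (len s)%:R : R).
  exact: (rmeasurable_word_length hG oU U0 Ugen (fun n => 1 + n%:R : R)).
have mx := cmeasurable_normc (weighted_cmeasurable Ax).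
have mz := cmeasurable_normc (weighted_cmeasurable Az).
have mK : rmeasurable (fun s => (1 + (len s)%:R) * (normc (x s) * normc (z (t - s)))).
  apply: rmeasurableM => //; apply: rmeasurableM => //.
  exact: (rmeasurable_subl t mz).
have H p q : 0 < p -> 0 < q -> nrm x < p -> nrm z < q ->
    (nint mu (fun s => (1 + (len s)%:R) * (normc (x s) * normc (z (t - s)%R)))%R <=
     (omega t * M * (p * q))%:E)%E.
  move=> p0 q0 xp zq.
  pose F s := phi (normc (x s) * omega s / p).
  pose H s := phi (normc (z s) * omega s / q).
  have mF : rmeasurable F.
    apply: rmeasurable_yfun => //; apply: rmeasurableM; last exact: rmeasurable_cst.
    by apply: rmeasurableM => //; exact: rmeasurable_weight.
  have mH : rmeasurable H.
    apply: rmeasurable_yfun => //; apply: rmeasurableM; last exact: rmeasurable_cst.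
    by apply: rmeasurableM => //; exact: rmeasurable_weight.
  have F0 s : 0 <= F s by exact: phi0.
  have H0 s : 0 <= H s by exact: phi0.
  have F1 : (nint mu F <= 1)%E by exact: weighted_modular_le1.
  have H1 : (nint mu (fun s => H (t - s)%R) <= 1)%E.
    by rewrite (nint_subl hG lcG hmu t mH (fun s => phi0 _)); exact: weighted_modular_le1.
  have mHt : rmeasurable (fun s => H (t - s)) by exact: rmeasurable_subl.
  have mpsi := rmeasurable_psi_weight a.
  have mpsi2 : rmeasurable (fun s => 2 * psi (a / omega s)).
    by apply: rmeasurableM => //; exact: rmeasurable_cst.
  have mFH : rmeasurable (fun s => F s + H (t - s)) by exact: rmeasurableD.
  apply: (@le_trans _ _ (nint mu (fun s => p * q * (omega t * (2 * C / a ^+ 2)) *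
      (F s + H (t - s) + 2 * psi (a / omega s)))%R)).
    apply: nint_le => //.
    - by apply: rmeasurableM; [exact: rmeasurable_cst|exact: rmeasurableD].
    - by move=> s; rewrite mulr_ge0 ?addr_ge0// mulr_ge0 ?normc_ge0.
    - move=> s.
      have := @weighted_product_le a C (normc (x s) * omega s / p)
        (normc (z (t - s)) * omega (t - s) / q) s t a0 (sC s).
      rewrite !divr_ge0 ?mulr_ge0 ?normc_ge0 ?(ltW (w0 _)) ?(ltW p0) ?(ltW q0)//.
      move=> /(_ isT isT) Hs.
      rewrite -[X in _ <= X]mulrA.
      apply: le_trans (ler_wpM2l (ltW (mulr_gt0 p0 q0)) Hs).
      rewrite le_eqVlt; apply/predU1P; left; field.
      by rewrite !gt_eqF.
  have pq0 : 0 <= p * q by rewrite mulr_ge0// ltW.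
  rewrite nintZ; last 3 first.
  - by apply: mulr_ge0 => //; apply: mulr_ge0 => //; exact: ltW.
  - exact: rmeasurableD.
  - by move=> s; apply: addr_ge0; [exact: addr_ge0|exact: mulr_ge0].
  rewrite nintD//; last 2 first.
  - by move=> s; exact: addr_ge0.
  - by move=> s; exact: mulr_ge0.
  rewrite nintD// nintZ// IE.
  apply: (@le_trans _ _ ((p * q * (omega t * (2 * C / a ^+ 2)))%:E * (2 + 2 * I)%:E)%E).
    apply: lee_wpmul2l.
      by rewrite lee_fin; apply: mulr_ge0 => //; apply: mulr_ge0 => //; exact: ltW.
    rewrite (_ : (2 + 2 * I)%:E = ((1 + 1) + 2%:E * I%:E)%E); last first.
      by rewrite -EFinM -!EFinD.
    by apply: leeD => //; exact: leeD.
  by rewrite -EFinM lee_fin le_eqVlt; apply/predU1P; left; rewrite /M; ring.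
have X0 := ba_norm_ge0 BA Ax; have Z0 := ba_norm_ge0 BA Az.
have N1 : nint mu (fun s =>
    (1 + (len s)%:R) * (normc (x s) * normc (z (t - s)))) \is a fin_num.
  rewrite ge0_fin_numE; last first.
    by apply: nint_ge0 => s; rewrite mulr_ge0 ?addr_ge0// mulr_ge0 ?normc_ge0.
  apply: le_lt_trans (H (nrm x + 1) (nrm z + 1) _ _ _ _) _; rewrite ?ltry ?ltrDl//.
    by rewrite ltr_wpDl.
  by rewrite ltr_wpDl.
rewrite -(fineK N1) lee_fin; set N := fine _.
pose k := omega t * M; have K0 : 0 <= k by rewrite mulr_ge0// ltW.
(* Let [p] and [q] decrease to the norms; the norms may vanish, which forbids
   normalising by them. *)
apply/ler_addgt0Pr => e e0.
pose d := Num.min 1 (e / (k * (nrm x + nrm z + 1) + 1)).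
have D0 : 0 < k * (nrm x + nrm z + 1) + 1.
  by rewrite ltr_wpDl// mulr_ge0// !addr_ge0.
have d0 : 0 < d by rewrite lt_min ltr01 divr_gt0.
have d1 : d <= 1 by rewrite ge_min lexx.
have de : d * (k * (nrm x + nrm z + 1) + 1) <= e.
  by rewrite -ler_pdivlMr// ge_min lexx orbT.
have := H (nrm x + d) (nrm z + d); rewrite -(fineK N1) lee_fin -/N !ltrDl.
rewrite !ltr_wpDl// => /(_ isT isT d0 d0) HN; apply: le_trans HN _.
rewrite -/k; move: X0 Z0 K0 de d0 d1; set X := nrm x; set Z := nrm z.
clearbody X Z k d => X0 Z0 K0 de d0 d1.
have : k * (d * d) <= k * d by rewrite ler_wpM2l// ler_piMl// ltW.
nra.
Qed.

End WeightedEstimate.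

(** * The derivation defined by a homomorphism *)

Section NonInner.
Context {R : realType} {V : lmodType R[i]}.

(** An inner derivation into the dual vanishes at [(x, x)], where it is the
difference of two equal values of a functional at [x * x]. *)
Lemma not_weakly_amenable_sub (A A' : set V) (mul : V -> V -> V) (nrm : V -> R)
    (D : V -> V -> R[i]) (x : V) :
  A' `<=` A -> bounded_derivation A mul nrm D -> A' x -> D x x != 0 ->
  ~ weakly_amenable A' mul nrm.
Proof.
move=> A'A [Ddual Dlin [K DK] Dleib] A'x Dx wa.
have : bounded_derivation A' mul nrm D.
  split.
  - move=> y /A'A Ay; have [Dl [k Dk]] := Ddual _ Ay; split.
      by move=> c u v /A'A Au /A'A Av; exact: Dl.
    by exists k => u /A'A; exact: Dk.
  - by move=> c u v w /A'A Au /A'A Av /A'A Aw; exact: Dlin.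
  - by exists K => u v /A'A Au /A'A Av; exact: DK.
  - by move=> u v w /A'A Au /A'A Av /A'A Aw; exact: Dleib.
by move=> /wa[f _ Df]; move: Dx; rewrite Df// subrr eqxx.
Qed.

End NonInner.

Section Derivation.
Context {R : realType} {G : topologicalZmodType}.
Variables (mu : {measure set (borel G) -> \bar R}).
Hypotheses (hG : hausdorff_space G) (lcG : locally_compact [set: G])
  (hmu : haar_measure mu).
Local Notation conv := (convolution mu).
Implicit Types (x y z : G -> R[i]) (s t : G).

Lemma convolutionC x y : cmeasurable x -> cmeasurable y -> conv x y = conv y x.
Proof.
move=> mx my; apply/funext => t; rewrite /convolution.
rewrite -(cintegral_subl hG lcG hmu t); last first.
  by apply: cmeasurableM => //; exact: cmeasurable_subl.
congr cintegral; apply/funext => s.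
by rewrite subKr mulrC.
Qed.

Variables (A : set (G -> R[i])) (nrm : (G -> R[i]) -> R).
Hypothesis BA : banach_algebra A conv nrm.
Hypothesis A_meas : forall x, A x -> cmeasurable x.
Hypothesis A_le : forall x y (C : R), A x -> cmeasurable y -> 0 <= C ->
  (forall s, normc (y s) <= C * normc (x s)) -> A y.
Hypothesis A_null : forall x, A x -> nrm x = 0 ->
  nint mu (fun s => normc (x s)) = 0%E.
Variables (ell : G -> R) (bnd : G -> R).
Hypotheses (ell0 : forall s, 0 <= ell s) (mell : rmeasurable ell).
Hypothesis A_bound : forall x z, A x -> A z -> forall t,
  (nint mu (fun s => (1 + ell s) * (normc (x s) * normc (z (t - s)%R)))%R <=
   (bnd t * (nrm x * nrm z))%:E)%E.
Variable chi : G -> R.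
Hypotheses (cchi : continuous chi)
  (chiD : forall s t, chi (s + t) = chi s + chi t)
  (chi_le : forall s, `|chi s| <= ell s).
Variables (B : set G) (b : R).
Hypotheses (mB : measurable (B : set (borel G))) (B_fin : (mu B < +oo)%E)
  (b0 : 0 <= b) (Bb : forall t, B t -> bnd t <= b).

Let chi_meas : rmeasurable chi. Proof. exact: continuous_borel_real. Qed.

Lemma scale_mem (c : R[i]) x : A x -> A (c *: x).
Proof. by move=> Ax; have := ba_linear BA c Ax (ba_zero BA); rewrite addr0. Qed.

Definition chimul x : G -> R[i] := fun s => (chi s)%:C%C * x s.

Lemma cmeasurable_chimul x : cmeasurable x -> cmeasurable (chimul x).
Proof. by move=> mx; apply: cmeasurableM => //; exact: cmeasurable_real. Qed.

(** Satisfied by [x] and by [chimul x] alike: one estimate then covers the products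
of the algebra and the products [chimul x * z], whose first factor may lie
outside the algebra. *)
Definition subordinate y x : Prop :=
  cmeasurable y /\ forall s, normc (y s) <= (1 + ell s) * normc (x s).

Lemma subordinate_refl x : A x -> subordinate x x.
Proof.
move=> Ax; split=> [|s]; first exact: A_meas.
by rewrite ler_peMl ?normc_ge0// lerDl.
Qed.

Lemma subordinate_chimul y x : cmeasurable y ->
  (forall s, normc (y s) <= normc (x s)) -> subordinate (chimul y) x.
Proof.
move=> my yx; split=> [|s]; first exact: cmeasurable_chimul.
rewrite /chimul normcM normc_real ler_pM ?normc_ge0//.
by apply: le_trans (chi_le s) _; rewrite lerDr.
Qed.

Let dom x z t s := (1 + ell s) * (normc (x s) * normc (z (t - s))).

Lemma rmeasurable_dom x z t : A x -> A z -> rmeasurable (dom x z t).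
Proof.
move=> /A_meas/cmeasurable_normc mx /A_meas/cmeasurable_normc mz.
apply: rmeasurableM; last by apply: rmeasurableM => //; exact: (rmeasurable_subl t mz).
by apply: rmeasurableD => //; exact: rmeasurable_cst.
Qed.

Lemma dom_fin x z t : A x -> A z -> (nint mu (dom x z t) < +oo)%E.
Proof. by move=> Ax Az; apply: le_lt_trans (A_bound Ax Az t) _; rewrite ltry. Qed.

Lemma normc_le_dom y w x z t s : subordinate y x ->
  (forall s, normc (w s) <= normc (z s)) ->
  normc (y s * w (t - s)) <= dom x z t s.
Proof.
move=> [_ yx] wz; rewrite normcM /dom mulrA.
by rewrite ler_pM ?normc_ge0.
Qed.

Lemma subordinate_cintegrable y x w z t : A x -> A z -> subordinate y x ->
  cmeasurable w -> (forall s, normc (w s) <= normc (z s)) ->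
  cintegrable mu (fun s => y s * w (t - s)).
Proof.
move=> Ax Az yx mw wz; apply: (@cintegrable_le _ _ _ _ (dom x z t)).
- by apply: cmeasurableM; [case: yx|exact: cmeasurable_subl].
- exact: rmeasurable_dom.
- by move=> s; exact: normc_le_dom.
- exact: dom_fin.
Qed.

Lemma convolution_le y x z t : A x -> A z -> subordinate y x ->
  normc (conv y z t) <= 2 * (bnd t * (nrm x * nrm z)).
Proof.
move=> Ax Az yx; have mz := A_meas Az.
apply: normc_cintegral_le.
  by apply: cmeasurableM; [case: yx|exact: cmeasurable_subl].
apply: le_trans (A_bound Ax Az t); apply: nint_le.
- apply: cmeasurable_normc.
  by apply: cmeasurableM; [case: yx|exact: cmeasurable_subl].
- exact: rmeasurable_dom.
- by move=> s; exact: normc_ge0.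
- by move=> s; exact: normc_le_dom.
Qed.

(** Pointwise convergence of both factors gives convergence of the convolution at
every point, because the dominating function is integrable for every [t]. *)
Lemma convolution_dominated (y_ : nat -> G -> R[i]) y x (z_ : nat -> G -> R[i]) z w t :
  A x -> A w -> (forall n, subordinate (y_ n) x) ->
  (forall n, cmeasurable (z_ n)) ->
  (forall n s, normc (z_ n s) <= normc (w s)) ->
  (forall s, ccvg (y_^~ s) (y s)) -> (forall s, ccvg (z_^~ s) (z s)) ->
  ccvg (fun n => conv (y_ n) (z_ n) t) (conv y z t).
Proof.
move=> Ax Aw yx mz zw cy cz.
apply: (cintegral_dominated (u := dom x w t)).
- by move=> n; apply: cmeasurableM; [case: (yx n)|exact: cmeasurable_subl].
- by move=> s; exact: ccvgM.
- exact: rmeasurable_dom.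
- exact: dom_fin.
- by move=> n s; exact: normc_le_dom.
Qed.

(** Truncating to a set on which [chi] is bounded keeps [chimul x] inside the
algebra, where products are known to be measurable and associative. *)
Definition chi_trunc n x : G -> R[i] :=
  fun s => (\1_([set s | `|chi s| <= n%:R] : set (borel G)) s : R)%:C%C * x s.

Lemma cmeasurable_trunc n x : cmeasurable x -> cmeasurable (chi_trunc n x).
Proof.
move=> mx; apply: cmeasurableM => //; apply: cmeasurable_real.
apply: rmeasurable_indic; rewrite (_ : [set _ | _] =
    (fun s : borel G => `|chi s|) @^-1` `]-oo, n%:R]%classic).
  have mn : rmeasurable (fun s => `|chi s|).
    exact: (rmeasurable_comp (@normr_measurable R setT) chi_meas).
  rewrite -[X in measurable X]setTI; exact: (mn measurableT _ (measurable_itv _)).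
by apply/seteqP; split=> s /=; rewrite in_itv.
Qed.

Lemma normc_trunc_le n x s : normc (chi_trunc n x s) <= normc (x s).
Proof.
rewrite /chi_trunc normcM normc_real indicE.
by case: (_ \in _); rewrite ?normr1 ?mul1r// normr0 mul0r normc_ge0.
Qed.

Lemma trunc_mem n x : A x -> A (chi_trunc n x).
Proof.
move=> Ax; apply: (A_le Ax (C := 1)) => //.
  by apply: cmeasurable_trunc; exact: A_meas.
by move=> s; rewrite mul1r; exact: normc_trunc_le.
Qed.

Lemma chimul_trunc_mem n x : A x -> A (chimul (chi_trunc n x)).
Proof.
move=> Ax; apply: (A_le Ax (C := n%:R)) => //.
  by apply: cmeasurable_chimul; apply: cmeasurable_trunc; exact: A_meas.
move=> s; rewrite /chimul /chi_trunc !normcM !normc_real indicE mulrA.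
rewrite ler_wpM2r ?normc_ge0//.
have [|_] := boolP (_ \in _); last by rewrite normr0 mulr0.
by rewrite inE /= normr1 mulr1.
Qed.

Lemma trunc_ccvg x s : ccvg (fun n => chi_trunc n x s) (x s).
Proof.
apply: (ccvg_near_cst (N := Num.bound `|chi s|)) => n Nn.
rewrite /chi_trunc indicE mem_set ?mul1r//=.
apply: le_trans (ltW (archi_boundP (normr_ge0 _))) _.
by rewrite ler_nat.
Qed.

(** Joint measurability of [x s * z (t - s)] may fail; the convolution is measurable
as a pointwise limit of products in the algebra. *)
Lemma cmeasurable_convolution x z : A x -> A z -> cmeasurable (conv (chimul x) z).
Proof.
move=> Ax Az.
apply: (cmeasurable_ccvg (f_ := fun n => conv (chimul (chi_trunc n x)) z)).
  by move=> n; apply: A_meas; apply: (ba_mul BA) => //; exact: chimul_trunc_mem.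
move=> t; apply: (convolution_dominated (x := x) (w := z)) => //.
- move=> n; apply: subordinate_chimul; last by move=> s; exact: normc_trunc_le.
  by apply: cmeasurable_trunc; exact: A_meas.
- by move=> _; exact: A_meas.
- by move=> s; apply: ccvgM; [exact: ccvg_cst|exact: trunc_ccvg].
- by move=> s; exact: ccvg_cst.
Qed.

Definition restr_integral (w : G -> R[i]) : R[i] :=
  cintegral mu (fun t => (\1_B t : R)%:C%C * w t).

Let nint_indic (c : R) : 0 <= c ->
  nint mu (fun t => c * \1_B t) = (c * fine (mu B))%:E.
Proof.
move=> c0; rewrite nintZ//; last exact: (rmeasurable_indic (R := R) mB).
by rewrite /nint integral_indic// setIT EFinM fineK// ge0_fin_numE.
Qed.

Let mindic (c : R) : rmeasurable (fun t => c * \1_B t).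
Proof. by apply: rmeasurableM; [exact: rmeasurable_cst|exact: rmeasurable_indic]. Qed.

Lemma cmeasurable_restr w : cmeasurable w ->
  cmeasurable (fun t => (\1_B t : R)%:C%C * w t).
Proof.
move=> mw; apply: cmeasurableM => //; apply: cmeasurable_real.
exact: rmeasurable_indic.
Qed.

Lemma normc_restr_le w (c : R) t : (forall t, B t -> normc (w t) <= c) ->
  normc ((\1_B t : R)%:C%C * w t) <= c * \1_B t.
Proof.
move=> wc; rewrite normcM normc_real indicE.
have [|_] := boolP (_ \in _); last by rewrite normr0 mul0r mulr0.
by rewrite inE normr1 mul1r mulr1; exact: wc.
Qed.

Lemma restr_cintegrable w (c : R) : cmeasurable w -> 0 <= c ->
  (forall t, B t -> normc (w t) <= c) ->
  cintegrable mu (fun t => (\1_B t : R)%:C%C * w t).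
Proof.
move=> mw c0 wc; apply: (@cintegrable_le _ _ _ _ (fun t => c * \1_B t)) => //.
- exact: cmeasurable_restr.
- by move=> t; exact: normc_restr_le.
- by rewrite nint_indic// ltry.
Qed.

Lemma restr_integral_le w (c : R) : cmeasurable w -> 0 <= c ->
  (forall t, B t -> normc (w t) <= c) ->
  normc (restr_integral w) <= 2 * (c * fine (mu B)).
Proof.
move=> mw c0 wc; apply: normc_cintegral_le; first exact: cmeasurable_restr.
rewrite -nint_indic//; apply: nint_le => //.
- by apply: cmeasurable_normc; exact: cmeasurable_restr.
- by move=> t; exact: normc_ge0.
- by move=> t; exact: normc_restr_le.
Qed.

Lemma convolution_le_on y x z t : A x -> A z -> subordinate y x -> B t ->
  normc (conv y z t) <= 2 * b * (nrm x * nrm z).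
Proof.
move=> Ax Az yx Bt; apply: le_trans (convolution_le t Ax Az yx) _.
rewrite -mulrA ler_wpM2l// ler_wpM2r ?Bb//.
by apply: mulr_ge0; exact: (ba_norm_ge0 BA).
Qed.

Let cst_ge0 x z : A x -> A z -> 0 <= 2 * b * (nrm x * nrm z).
Proof.
move=> Ax Az; apply: mulr_ge0; first exact: mulr_ge0.
by apply: mulr_ge0; exact: (ba_norm_ge0 BA).
Qed.

Lemma restr_convolution_cintegrable y x z : A x -> A z -> subordinate y x ->
  cmeasurable (conv y z) ->
  cintegrable mu (fun t => (\1_B t : R)%:C%C * conv y z t).
Proof.
move=> Ax Az yx mc; apply: (restr_cintegrable (c := 2 * b * (nrm x * nrm z))) => //.
  exact: cst_ge0.
by move=> t Bt; exact: convolution_le_on.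
Qed.

(** Formally [z |-> \int_B (chi x) * z] is the image of the indicator of [B] under
the module action of [chimul x], and [chimul] is a derivation of the
convolution since [chi t = chi s + chi (t - s)]. *)
Definition chi_derivation x z : R[i] := restr_integral (conv (chimul x) z).

Lemma subordinate_chimul_refl x : A x -> subordinate (chimul x) x.
Proof. by move=> Ax; apply: subordinate_chimul => //; exact: A_meas. Qed.

Lemma chi_derivation_le x z : A x -> A z ->
  normc (chi_derivation x z) <= 4 * b * fine (mu B) * nrm x * nrm z.
Proof.
move=> Ax Az.
apply: le_trans (@restr_integral_le _ (2 * b * (nrm x * nrm z)) _ _ _) _.
- exact: cmeasurable_convolution.
- exact: cst_ge0.
- by move=> t Bt; apply: convolution_le_on => //; exact: subordinate_chimul_refl.
- by rewrite le_eqVlt; apply/predU1P; left; ring.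
Qed.

Lemma convolution_linearl (c : R[i]) y y' x x' z t : A x -> A x' -> A z ->
  subordinate y x -> subordinate y' x' ->
  conv (fun s => c * y s + y' s) z t = c * conv y z t + conv y' z t.
Proof.
move=> Ax Ax' Az yx yx'; have mz := A_meas Az.
have i1 := subordinate_cintegrable t Ax Az yx mz (fun s => lexx _).
have i2 := subordinate_cintegrable t Ax' Az yx' mz (fun s => lexx _).
rewrite /convolution -cintegralZ// -cintegralD//.
  by congr cintegral; apply/funext => s; rewrite mulrDl mulrA.
exact: cintegrableZ.
Qed.

Lemma chi_derivation_linearl (c : R[i]) x y z : A x -> A y -> A z ->
  chi_derivation (c *: x + y) z = c * chi_derivation x z + chi_derivation y z.
Proof.
move=> Ax Ay Az.
have sx := subordinate_chimul_refl Ax; have sy := subordinate_chimul_refl Ay.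
have ix := restr_convolution_cintegrable Ax Az sx (cmeasurable_convolution Ax Az).
have iy := restr_convolution_cintegrable Ay Az sy (cmeasurable_convolution Ay Az).
rewrite /chi_derivation /restr_integral -cintegralZ// -cintegralD//; last first.
  exact: cintegrableZ.
congr cintegral; apply/funext => t.
rewrite (_ : chimul _ = fun s => c * chimul x s + chimul y s); last first.
  by apply/funext => s; rewrite /chimul /= mulrDr mulrCA.
by rewrite (convolution_linearl c t Ax Ay Az sx sy) mulrDr mulrCA.
Qed.

Lemma chi_derivation_linearr (c : R[i]) x y z : A x -> A y -> A z ->
  chi_derivation z (c *: x + y) = c * chi_derivation z x + chi_derivation z y.
Proof.
move=> Ax Ay Az.
have sz := subordinate_chimul_refl Az.
have ix := restr_convolution_cintegrable Az Ax sz (cmeasurable_convolution Az Ax).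
have iy := restr_convolution_cintegrable Az Ay sz (cmeasurable_convolution Az Ay).
rewrite /chi_derivation /restr_integral -cintegralZ// -cintegralD//; last first.
  exact: cintegrableZ.
congr cintegral; apply/funext => t.
have i1 := subordinate_cintegrable t Az Ax sz (A_meas Ax) (fun s => lexx _).
have i2 := subordinate_cintegrable t Az Ay sz (A_meas Ay) (fun s => lexx _).
rewrite mulrCA -mulrDr; congr (_ * _).
rewrite /convolution -cintegralZ// -cintegralD//; last exact: cintegrableZ.
by congr cintegral; apply/funext => s /=; rewrite mulrDr mulrCA.
Qed.

Lemma chi_derivation_dominated (x_ : nat -> G -> R[i]) x w
    (z_ : nat -> G -> R[i]) z v :
  A w -> A v -> (forall n, A (x_ n)) -> (forall n, A (z_ n)) ->
  (forall n s, normc (x_ n s) <= normc (w s)) ->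
  (forall n s, normc (z_ n s) <= normc (v s)) ->
  (forall s, ccvg (x_^~ s) (x s)) -> (forall s, ccvg (z_^~ s) (z s)) ->
  ccvg (fun n => chi_derivation (x_ n) (z_ n)) (chi_derivation x z).
Proof.
move=> Aw Av Ax Az xw zv cx cz.
have sxw n : subordinate (chimul (x_ n)) w.
  by apply: subordinate_chimul => //; exact: A_meas.
apply: (cintegral_dominated (u := fun t => 2 * b * (nrm w * nrm v) * \1_B t)) => //.
- by move=> n; apply: cmeasurable_restr; exact: cmeasurable_convolution.
- move=> t; apply: ccvgM; first exact: ccvg_cst.
  apply: (convolution_dominated (x := w) (w := v)) => //.
  + by move=> n; exact: A_meas.
  + by move=> s; apply: ccvgM => //; exact: ccvg_cst.
- by rewrite nint_indic ?ltry//; exact: cst_ge0.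
- move=> n t; apply: normc_restr_le => {}t Bt.
  apply: (@le_trans _ _ (2 * (bnd t * (nrm w * nrm v)))); last first.
    rewrite -mulrA ler_wpM2l// ler_wpM2r ?Bb//.
    by apply: mulr_ge0; exact: (ba_norm_ge0 BA).
  have mi : cmeasurable (fun s => chimul (x_ n) s * z_ n (t - s)).
    apply: cmeasurableM; first by case: (sxw n).
    by apply: cmeasurable_subl; exact: A_meas.
  apply: normc_cintegral_le => //; apply: le_trans (A_bound Aw Av t).
  apply: nint_le.
  + exact: cmeasurable_normc.
  + exact: rmeasurable_dom.
  + by move=> s; exact: normc_ge0.
  + by move=> s; exact: normc_le_dom.
Qed.

(** Associativity holds up to elements of norm 0, and these are null functions. *)
Lemma restr_integral_null (w w' : G -> R[i]) : A w -> A w' -> nrm (w - w') = 0 ->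
  cintegrable mu (fun t => (\1_B t : R)%:C%C * w t) ->
  cintegrable mu (fun t => (\1_B t : R)%:C%C * w' t) ->
  restr_integral w = restr_integral w'.
Proof.
move=> Aw Aw' ww' iw iw'.
have Ad : A (w - w').
  by rewrite addrC -scaleN1r; exact: ba_linear BA _ _ _ Aw' Aw.
have d0 := A_null Ad ww'.
apply/eqP; rewrite -subr_eq0; apply/eqP; apply: eq0_normc; apply/eqP.
rewrite eq_le normc_ge0 andbT -(mulr0 2).
have -> : restr_integral w - restr_integral w' = restr_integral (w - w').
  rewrite /restr_integral -mulN1r -cintegralZ// -cintegralD//; last exact: cintegrableZ.
  congr cintegral; apply/funext => t /=.
  by rewrite mulrBr mulN1r.
apply: normc_cintegral_le; first by apply: cmeasurable_restr; exact: A_meas.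
rewrite [leRHS](_ : _ = nint mu (fun s => normc ((w - w') s))); last by rewrite d0.
apply: nint_le.
- by apply: cmeasurable_normc; apply: cmeasurable_restr; exact: A_meas.
- by apply: cmeasurable_normc; exact: A_meas.
- by move=> s; exact: normc_ge0.
- move=> s; rewrite normcM normc_real indicE.
  by case: (_ \in _); rewrite ?normr1 ?mul1r// normr0 mul0r normc_ge0.
Qed.

Lemma chimul_convolution x y : A x -> A y ->
  chimul (conv x y) = fun t => 1 * conv (chimul x) y t + conv x (chimul y) t.
Proof.
move=> Ax Ay; apply/funext => t.
have ix := subordinate_cintegrable t Ax Ay (subordinate_chimul_refl Ax) (A_meas Ay)
  (fun s => lexx _).
have i0 := subordinate_cintegrable t Ax Ay (subordinate_refl Ax) (A_meas Ay)
  (fun s => lexx _).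
have iy : cintegrable mu (fun s => x s * chimul y (t - s)).
  rewrite (_ : (fun s => _) = fun s => (chi t)%:C%C * (x s * y (t - s)) +
      (-1) * (chimul x s * y (t - s))).
    by apply: cintegrableD; exact: cintegrableZ.
  apply/funext => s; rewrite /chimul.
  have -> : chi t = chi s + chi (t - s) by rewrite -chiD addrC subrK.
  by rewrite rmorphD/=; ring.
rewrite mul1r /chimul /convolution -cintegralZ// -cintegralD//.
congr cintegral; apply/funext => s; rewrite /chimul.
have -> : chi t = chi s + chi (t - s) by rewrite -chiD addrC subrK.
by rewrite rmorphD/=; ring.
Qed.

(** When [chimul x] and [chimul y] belong to the algebra, the rule is
[chi (x y) z = (chi x) (y z) + x (chi y) z], rearranged by associativity and
commutativity. *)
Lemma chi_derivation_leibniz_trunc x y z : A x -> A y -> A z ->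
  A (chimul x) -> A (chimul y) ->
  chi_derivation (conv x y) z =
  chi_derivation y (conv z x) + chi_derivation x (conv y z).
Proof.
move=> Ax Ay Az Acx Acy.
have AM := ba_mul BA.
have mz := A_meas Az.
have sr p : A p -> subordinate p p by exact: subordinate_refl.
have int p q : A p -> A q -> cintegrable mu (fun t => (\1_B t : R)%:C%C * conv p q t).
  move=> Ap Aq; apply: (restr_convolution_cintegrable Ap Aq (sr _ Ap)).
  by apply: A_meas; exact: AM.
have assoc p q r : A p -> A q -> A r ->
    restr_integral (conv (conv p q) r) = restr_integral (conv p (conv q r)).
  move=> Ap Aq Ar; have Apq := AM _ _ Ap Aq; have Aqr := AM _ _ Aq Ar.
  apply/esym; apply: (restr_integral_null (AM _ _ Ap Aqr) (AM _ _ Apq Ar)).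
  - exact: (ba_mulA BA).
  - exact: int.
  - exact: int.
rewrite {1}/chi_derivation (chimul_convolution Ax Ay).
have -> : conv (fun t => 1 * conv (chimul x) y t + conv x (chimul y) t) z =
    fun t => conv (conv (chimul x) y) z t + conv (conv x (chimul y)) z t.
  apply/funext => t.
  rewrite (convolution_linearl 1 t (AM _ _ Acx Ay) (AM _ _ Ax Acy) Az) ?mul1r//.
    by apply: sr; exact: AM.
  by apply: sr; exact: AM.
have -> : restr_integral (fun t =>
      conv (conv (chimul x) y) z t + conv (conv x (chimul y)) z t) =
    restr_integral (conv (conv (chimul x) y) z) +
    restr_integral (conv (conv x (chimul y)) z).
  rewrite /restr_integral -cintegralD; try by apply: int => //; exact: AM.
  by congr cintegral; apply/funext => t; rewrite mulrDr.
have E1 : restr_integral (conv (conv (chimul x) y) z) = chi_derivation x (conv y z).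
  exact: assoc.
have E2 : restr_integral (conv (conv x (chimul y)) z) = chi_derivation y (conv z x).
  have Cxy := convolutionC (A_meas Ax) (A_meas Acy).
  have Cxz := convolutionC (A_meas Ax) mz.
  apply: etrans (congr1 (fun w => restr_integral (conv w z)) Cxy) _.
  apply: etrans (assoc _ _ _ Acy Ax Az) _.
  exact: (congr1 (fun w => restr_integral (conv (chimul y) w)) Cxz).
have swap (a a' c c' : R[i]) : a = a' -> c = c' -> a + c = c' + a'.
  by move=> -> ->; exact: addrC.
exact: swap E1 E2.
Qed.

(** The convolution of the absolute values belongs to the algebra and dominates the
sequence, which allows a second passage to the limit. *)
Lemma convolution_seq_dominated (x_ y_ : nat -> G -> R[i]) x y : A x -> A y ->
  (forall n, A (x_ n)) -> (forall n, A (y_ n)) ->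
  (forall n s, normc (x_ n s) <= normc (x s)) ->
  (forall n s, normc (y_ n s) <= normc (y s)) ->
  (forall s, ccvg (x_^~ s) (x s)) -> (forall s, ccvg (y_^~ s) (y s)) ->
  (forall t, ccvg (fun n => conv (x_ n) (y_ n) t) (conv x y t)) /\
  exists2 w, A w & forall n t, normc (conv (x_ n) (y_ n) t) <= normc (w t).
Proof.
move=> Ax Ay Axn Ayn xx yy cx cy; split=> [t|].
  apply: (convolution_dominated (x := x) (w := y)) => //.
  - move=> n; split=> [|s]; first exact: A_meas.
    by apply: le_trans (xx n s) _; have [] := subordinate_refl Ax.
  - by move=> n; exact: A_meas.
have abs p : A p -> A (fun s => (normc (p s))%:C%C).
  move=> Ap; apply: (A_le Ap (C := 1)) => //.
    by apply: cmeasurable_real; apply: cmeasurable_normc; exact: A_meas.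
  by move=> s; rewrite mul1r normc_real ger0_norm// normc_ge0.
have ax := abs _ Ax; have ay := abs _ Ay.
exists (2%:C%C *: conv (fun s => (normc (x s))%:C%C) (fun s => (normc (y s))%:C%C)).
  by apply: scale_mem; exact: (ba_mul BA).
move=> n t.
rewrite (_ : (_ *: _) t = 2%:C%C *
  conv (fun s => (normc (x s))%:C%C) (fun s => (normc (y s))%:C%C) t)//.
rewrite normcM normc_real ger0_norm//.
have mx := cmeasurable_normc (A_meas Ax); have my := cmeasurable_normc (A_meas Ay).
have mxy : rmeasurable (fun s => normc (x s) * normc (y (t - s))).
  by apply: rmeasurableM => //; exact: (rmeasurable_subl t my).
rewrite {2}/convolution.
rewrite (_ : (fun s => _ * _) = fun s => (normc (x s) * normc (y (t - s)))%:C%C); last first.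
  by apply/funext => s; rewrite rmorphM.
rewrite cintegral_real// normc_real ger0_norm; last first.
  by apply: fine_ge0; apply: nint_ge0 => s; rewrite mulr_ge0 ?normc_ge0.
have mi : cmeasurable (fun s => x_ n s * y_ n (t - s)).
  by apply: cmeasurableM; [exact: A_meas|apply: cmeasurable_subl; exact: A_meas].
apply: normc_cintegral_le => //; rewrite fineK.
  apply: nint_le => //.
  - exact: cmeasurable_normc.
  - by move=> s; exact: normc_ge0.
  - by move=> s; rewrite normcM ler_pM ?normc_ge0.
rewrite ge0_fin_numE; last by apply: nint_ge0 => s; rewrite mulr_ge0 ?normc_ge0.
apply: le_lt_trans (dom_fin t Ax Ay); apply: nint_le => //.
- exact: rmeasurable_dom.
- by move=> s; rewrite mulr_ge0 ?normc_ge0.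
- by move=> s; rewrite /dom ler_peMl ?mulr_ge0 ?normc_ge0// lerDl.
Qed.

(** The truncated identity passes to the limit in each of its three terms. *)
Lemma chi_derivation_leibniz x y z : A x -> A y -> A z ->
  chi_derivation (conv x y) z =
  chi_derivation y (conv z x) + chi_derivation x (conv y z).
Proof.
move=> Ax Ay Az; have AM := ba_mul BA.
pose x_ n := chi_trunc n x; pose y_ n := chi_trunc n y.
have Axn n : A (x_ n) by exact: trunc_mem.
have Ayn n : A (y_ n) by exact: trunc_mem.
have xx n s : normc (x_ n s) <= normc (x s) by exact: normc_trunc_le.
have yy n s : normc (y_ n s) <= normc (y s) by exact: normc_trunc_le.
have cx s : ccvg (x_^~ s) (x s) by exact: trunc_ccvg.
have cy s : ccvg (y_^~ s) (y s) by exact: trunc_ccvg.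
have cz s : ccvg (fun=> z s) (z s) by exact: ccvg_cst.
have [cxy [wxy Axy xyw]] := convolution_seq_dominated Ax Ay Axn Ayn xx yy cx cy.
have [cyz [wyz Ayz yzw]] := convolution_seq_dominated Ay Az Ayn (fun=> Az) yy
  (fun _ s => lexx _) cy cz.
have [czx [wzx Azx zxw]] := convolution_seq_dominated Az Ax (fun=> Az) Axn
  (fun _ s => lexx _) xx cz cx.
have C1 : ccvg (fun n => chi_derivation (conv (x_ n) (y_ n)) z)
    (chi_derivation (conv x y) z).
  by apply: (chi_derivation_dominated (w := wxy) (v := z)) => // n; exact: AM.
have C2 : ccvg (fun n => chi_derivation (y_ n) (conv z (x_ n)))
    (chi_derivation y (conv z x)).
  by apply: (chi_derivation_dominated (w := y) (v := wzx)) => // n; exact: AM.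
have C3 : ccvg (fun n => chi_derivation (x_ n) (conv (y_ n) z))
    (chi_derivation x (conv y z)).
  by apply: (chi_derivation_dominated (w := x) (v := wyz)) => // n; exact: AM.
apply: (ccvg_unique C1).
have -> : (fun n => chi_derivation (conv (x_ n) (y_ n)) z) =
    fun n => chi_derivation (y_ n) (conv z (x_ n)) +
             chi_derivation (x_ n) (conv (y_ n) z).
  apply/funext => n; apply: chi_derivation_leibniz_trunc => //;
    exact: chimul_trunc_mem.
exact: ccvgD.
Qed.

Lemma chi_derivation_bounded_derivation : bounded_derivation A conv nrm chi_derivation.
Proof.
split.
- move=> x Ax; split; first by move=> c y z Ay Az; exact: chi_derivation_linearr.
  by exists (4 * b * fine (mu B) * nrm x) => z Az; exact: chi_derivation_le.
- by move=> c x y z; exact: chi_derivation_linearl.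
- by exists (4 * b * fine (mu B)); exact: chi_derivation_le.
- exact: chi_derivation_leibniz.
Qed.

(** For [x] positive on [V] and zero elsewhere, the value at [(x, x)] is the
integral over [e + V] of [h t s = chi s * w s * w (t - s)].  For [t] in [e + V]
the function [h t] is positive on the open set of those [s] in [V] with [t - s] in
[V], which contains [t - e]. *)
Lemma chi_derivation_neq0 (w : G -> R) (V : set G) (e : G) :
  open V -> V e -> B = [set t | V (t - e)] -> (forall s, V s -> 0 < chi s) ->
  rmeasurable w -> (forall s, V s -> 0 < w s) -> (forall s, ~ V s -> w s = 0) ->
  A (fun s => (w s)%:C%C) ->
  chi_derivation (fun s => (w s)%:C%C) (fun s => (w s)%:C%C) != 0.
Proof.
move=> oV Ve BE chiV mw wV wnV; set x := fun s => (w s)%:C%C => Ax.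
pose h t s := chi s * w s * w (t - s).
have h0 t s : 0 <= h t s.
  rewrite /h; have [Vs|/wnV ->] := pselect (V s); last by rewrite mulr0 mul0r.
  have [Vts|/wnV ->] := pselect (V (t - s)); last by rewrite mulr0.
  by rewrite !mulr_ge0 ?(ltW (chiV _ _)) ?(ltW (wV _ _)).
have mh t : rmeasurable (h t).
  by apply: rmeasurableM; [exact: rmeasurableM|exact: (rmeasurable_subl t mw)].
have hE t s : chimul x s * x (t - s) = (h t s)%:C%C.
  by rewrite /chimul /x /h !rmorphM.
pose k t := fine (nint mu (h t)).
have cE : conv (chimul x) x = fun t => (k t)%:C%C.
  apply/funext => t; rewrite /k -cintegral_real// /convolution.
  by congr cintegral; apply/funext => s; exact: hE.
have h_fin t : (nint mu (h t) < +oo)%E.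
  have [_] := subordinate_cintegrable t Ax Ax (subordinate_chimul_refl Ax) (A_meas Ax)
    (fun s => lexx _).
  congr (_ < _)%E; apply: eq_integral => s _.
  by rewrite hE normc_real ger0_norm.
have k0 t : 0 <= k t by apply: fine_ge0; exact: nint_ge0.
have mk : rmeasurable k.
  by have [+ _] := cmeasurable_convolution Ax Ax; rewrite cE.
have kB t : B t -> 0 < k t.
  rewrite BE /= => Bt; rewrite /k fine_gt0// h_fin andbT.
  have oW : open (V `&` [set s | V (t - s)]) by apply: openI => //; exact: open_subl.
  apply: (nint_gt0 (mh t) (h0 t) (open_borel oW)).
    apply: (haar_open_gt0 hG hmu oW); exists (t - e); split => //=.
    by rewrite subKr.
  by move=> s [Vs /= Vts]; rewrite /h !mulr_gt0 ?chiV ?wV.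
have oB : open B by rewrite BE; exact: open_subr.
have B0 : (0 < mu B)%E.
  by apply: (haar_open_gt0 hG hmu oB); exists (e + e); rewrite BE /= addrK.
pose g t := \1_B t * k t.
have mg : rmeasurable g by apply: rmeasurableM => //; exact: rmeasurable_indic.
have g0 t : 0 <= g t by rewrite mulr_ge0// indicE.
have gE t : (\1_B t : R)%:C%C * conv (chimul x) x t = (g t)%:C%C.
  by rewrite cE /g rmorphM.
have [_ g_fin] := restr_convolution_cintegrable Ax Ax (subordinate_chimul_refl Ax)
  (cmeasurable_convolution Ax Ax).
have -> : chi_derivation x x = (fine (nint mu g))%:C%C.
  rewrite -cintegral_real// /chi_derivation /restr_integral.
  by congr cintegral; apply/funext => t; exact: gE.
rewrite fmorph_eq0 gt_eqF// fine_gt0//; apply/andP; split.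
  apply: (nint_gt0 mg g0 mB B0) => t Bt.
  by rewrite /g indicE mem_set// mul1r kB.
move: g_fin; congr (_ < _)%E; apply: eq_integral => s _.
by rewrite gE normc_real ger0_norm.
Qed.

End Derivation.

(** * Failure of weak amenability for an abstract generating set *)

Section AbstractTheorem.
Context {R : realType} {G : topologicalZmodType}.
Variables (mu : {measure set (borel G) -> \bar R}) (U : set G).
Hypotheses (hG : hausdorff_space G) (lcG : locally_compact [set: G])
  (hmu : haar_measure mu).
Hypotheses (oU : open U) (U0 : U 0) (Ugen : forall s, exists n, sumset U n s)
  (Usym : forall s, U s -> U (- s)).
Variables Phi Psi : R -> \bar R.
Hypotheses (pair : complementary_pair Phi Psi)
  (ciPhi : continuous_increasing Phi) (ciPsi : continuous_increasing Psi)
  (yPhi_sqrt : young_function (fun x => Phi (Num.sqrt x))).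
Variables (nu : nat -> R) (omega : G -> R).
Hypotheses (nu_mono : forall p q, (p <= q)%N -> nu p <= nu q)
  (nu_subadd : forall p q, nu (p + q)%N <= nu p + nu q)
  (nu0 : nu 0%N = 0)
  (omegaE : forall t, omega t = expR (nu (word_length U t))).
Hypothesis omega_inv : orlicz_space mu Psi (fun t => ((omega t)^-1)%:C%C).
Let yPhi : young_function Phi. Proof. by case: pair. Qed.
Local Notation phi := (yfun Phi).
Local Notation A := (weighted_space omega (orlicz_space mu Phi)).
Local Notation S := (weighted_space omega (orlicz_step_space mu Phi)).
Local Notation nrm := (weighted_norm mu Phi omega).
Local Notation conv := (convolution mu).
Hypothesis BA : banach_algebra A conv nrm.

(** If [x] has norm 0 then so have its multiples: the modular of [(n + 1) * x] is at
most 1, while it is at least [n + 1] times that of [x]. *)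
Lemma weighted_null x : A x -> nrm x = 0 -> nint mu (fun s => normc (x s)) = 0%E.
Proof.
move=> Ax x0; have w0 := weight_gt0 omegaE.
have phi0 r : 0 <= phi r by exact: (yfun_ge0 yPhi ciPhi.2).
have mx := cmeasurable_normc (weighted_cmeasurable hG oU U0 Ugen omegaE Ax).
have mw := rmeasurable_weight hG oU U0 Ugen omegaE.
have mxw : rmeasurable (fun s => normc (x s) * omega s) by exact: rmeasurableM.
have mp : rmeasurable (fun s => phi (normc (x s) * omega s)) by exact: rmeasurable_yfun.
apply: (nint_eq0 mp mx) => [//|s|s|]; first exact: normc_ge0.
  move=> /eqP; apply: contraTeq => xs.
  rewrite gt_eqF//; apply: (yfun_gt0 yPhi ciPhi.2).
  by rewrite mulr_gt0// lt0r xs normc_ge0.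
set J := nint _ _; have J0 : (0 <= J)%E by exact: nint_ge0.
have H n : (n.+1%:R%:E * J <= 1)%E.
  have n0 : 0 < n.+1%:R^-1 :> R by rewrite invr_gt0 ltr0n.
  have := @weighted_modular_le1 R G mu U Phi Psi pair ciPhi ciPsi nu omega omegaE
    BA x n.+1%:R^-1 Ax n0.
  rewrite x0 => /(_ n0); apply: le_trans; rewrite -nintZ//.
  apply: nint_le.
  - by apply: rmeasurableM => //; exact: rmeasurable_cst.
  - apply: rmeasurable_yfun => //.
    by apply: rmeasurableM => //; exact: rmeasurable_cst.
  - by move=> s; rewrite mulr_ge0.
  - move=> s; rewrite invrK [_ * n.+1%:R]mulrC.
    apply: (yfun_scale_ge yPhi ciPhi.2).
    by rewrite mulr_ge0 ?normc_ge0// ltW.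
have J_fin : J \is a fin_num.
  rewrite ge0_fin_numE//; have := H 0%N; rewrite mul1e => J1.
  by apply: le_lt_trans J1 _; rewrite ltry.
move: H J0; rewrite -(fineK J_fin); set j := fine J => H; rewrite lee_fin => j0.
congr (_%:E); apply/eqP; rewrite eq_le j0 andbT leNgt; apply/negP => j1.
have := archi_boundP (ltW (_ : 0 < j^-1)); rewrite invr_gt0 => /(_ j1).
set n := Num.bound _; rewrite -[ltLHS]mul1r ltr_pdivrMr// => jn.
have := H n; rewrite -EFinM lee_fin -natr1 leNgt => /negP; apply.
by apply: lt_le_trans jn _; rewrite mulrDl lerDl mul1r.
Qed.

(** Dividing by the weight makes the weighted function an indicator, so that
membership requires no local bound on the weight and the function belongs to
the closure of the step functions as well. *)
Lemma test_function_mem (V : set G) : open V -> (mu V < +oo)%E ->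
  A (fun s => (\1_V s / omega s)%:C%C) /\ S (fun s => (\1_V s / omega s)%:C%C).
Proof.
move=> oV V_fin; have w0 := weight_gt0 omegaE.
have mV := open_borel oV.
have mf : cmeasurable (fun s : G => (\1_V s : R)%:C%C).
  by apply: cmeasurable_real; exact: rmeasurable_indic.
have fE : weigh omega (fun s => (\1_V s / omega s)%:C%C) = fun s => (\1_V s)%:C%C.
  by apply/funext => s; rewrite /weigh -rmorphM/= divfK// gt_eqF.
have phi0 r : 0 <= phi r by exact: (yfun_ge0 yPhi ciPhi.2).
have Lf : orlicz_space mu Phi (fun s => (\1_V s)%:C%C).
  apply/(orlicz_spaceP mu pair ciPhi); split => //; exists 1 => //.
  apply: (@le_lt_trans _ _ (nint mu (fun s => phi 1 * \1_V s)%R)).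
    apply: nint_le => //.
    - exact: (rmeasurable_modular pair ciPhi).
    - apply: rmeasurableM; first exact: rmeasurable_cst.
      exact: rmeasurable_indic.
    - move=> s; rewrite normc_real indicE; case: (_ \in _).
        by rewrite normr1 !mulr1.
      by rewrite normr0 !mulr0 (yfun0 yPhi).
  rewrite nintZ//; last exact: (rmeasurable_indic (R := R) mV).
  by rewrite /nint integral_indic// setIT lte_mul_pinfty// lee_fin.
split; rewrite /weighted_space/= fE//; split => // r r0.
exists (fun s => (\1_V s)%:C%C); split => //.
  split => //; apply: (@sub_finite_set _ _ [set (0 : R[i]); 1]).
    by move=> _ [s _ <-]; rewrite indicE; case: (_ \in _); [right|left].
  by rewrite finite_setU; split; exact: finite_set1.
apply: (@le_lt_trans _ _ 0%E); last by rewrite lte_fin.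
apply: ge_ereal_sup => _ [v _ <-].
rewrite (eq_integral (cst 0%E)) ?integral0// => s _.
by rewrite subrr (_ : _ * v s = 0) ?normc0//; exact: mul0r.
Qed.

Theorem weighted_orlicz_not_weakly_amenable (chi : G -> R) (e : G) :
  continuous chi -> (forall s t, chi (s + t) = chi s + chi t) ->
  (forall s, U s -> `|chi s| <= 1) -> U e -> 0 < chi e ->
  ~ weakly_amenable A conv nrm /\ ~ weakly_amenable S conv nrm.
Proof.
move=> cchi chiD chi1 Ue chie.
have U_growth := haar_sumset_ge hG hmu oU U0 cchi chiD Ue chie.
have w0 := weight_gt0 omegaE.
have [M M0 AM] := weighted_convolution_bound hG lcG hmu oU U0 Ugen Usym pair
  ciPhi ciPsi yPhi_sqrt nu_mono nu_subadd nu0 omegaE omega_inv U_growth BA.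
have [N cN N0] := compact_nbhs0 lcG.
pose V : set G := U `&` [set s | chi e / 2 < chi s] `&` [set s | N° (- e + s)].
have oV : open V.
  apply: openI; last by apply: open_addl; exact: open_interior.
  apply: openI => //; rewrite (_ : [set _ | _] = chi @^-1` `]chi e / 2, +oo[%classic).
    by apply: open_comp => [s _|]; [exact: cchi|exact: interval_open].
  by apply/seteqP; split=> s /=; rewrite in_itv/= andbT.
have Ve : V e.
  split; first by split => //=; rewrite gtr_pMr// invf_lt1// ltr1n.
  by rewrite /= addNr.
have mN : measurable (N : set (borel G)) by exact: compact_borel.
have V_fin : (mu V < +oo)%E.
  apply: le_lt_trans (haar_compact hmu cN); rewrite -(haar_addl hmu (- e) mN).
  apply: le_measure; rewrite ?inE; first exact: open_borel.
    exact: measurable_addl.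
  by move=> s [_ /=]; exact: interior_subset.
pose B : set G := [set t | V (t - e)].
have mB : measurable (B : set (borel G)).
  by apply: open_borel; exact: open_subr.
have B_fin : (mu B < +oo)%E by rewrite haar_addr//; exact: open_borel.
pose b := expR (nu 2) * M.
have b0 : 0 <= b by rewrite mulr_ge0// expR_ge0.
have Bb t : B t -> omega t * M <= b.
  move=> [[Ute _] _]; rewrite ler_wpM2r// omegaE ler_expR; apply: nu_mono.
  apply: word_length_le; apply/sumsetS; exists e => //; exact: sumset1.
have chi_le := additive_le_word_length U0 Ugen chiD chi1.
have mell : rmeasurable (fun s : G => (word_length U s)%:R : R).
  exact: (rmeasurable_word_length hG oU U0 Ugen (fun n => n%:R : R)).
have A_meas x : A x -> cmeasurable x by exact: (weighted_cmeasurable hG oU U0 Ugen omegaE).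
have A_le x y (C : R) : A x -> cmeasurable y -> 0 <= C ->
    (forall s, normc (y s) <= C * normc (x s)) -> A y.
  exact: (weighted_space_le hG oU U0 Ugen pair ciPhi omegaE).
have bd := chi_derivation_bounded_derivation hG lcG hmu BA A_meas A_le weighted_null
  (fun s => ler0n _ _) mell AM cchi chiD chi_le mB B_fin b0 Bb.
pose x0 : G -> R[i] := fun s => (\1_V s / omega s)%:C%C.
have [Ax0 Sx0] := test_function_mem oV V_fin.
have Dx0 : chi_derivation mu chi B x0 x0 != 0.
  apply: (chi_derivation_neq0 (w := fun s => \1_V s / omega s) hG hmu BA A_meas A_le
    mell AM cchi chi_le mB B_fin b0 Bb oV Ve erefl) => //.
  - by move=> s [[_ /= Vs] _]; apply: lt_trans Vs; rewrite divr_gt0.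
  - apply: rmeasurableM; first by apply: rmeasurable_indic; exact: open_borel.
    exact: (rmeasurable_weightV hG oU U0 Ugen omegaE).
  - by move=> s Vs; rewrite indicE mem_set// divr_gt0.
  - by move=> s Vs; rewrite indicE memNset// mul0r.
split; first exact: (not_weakly_amenable_sub (fun _ h => h) bd Ax0 Dx0).
apply: (not_weakly_amenable_sub _ bd Sx0 Dx0).
by move=> x [].
Qed.

End AbstractTheorem.

(** * The unit box and its coordinates *)

Section UnitBox.
Context {R : realType} {G T : topologicalZmodType} {k m : nat}.
Variable iota : G -> 'rV[R]_k * discrete_topology 'rV[int]_m * T.
Hypothesis iota_iso : topological_group_iso iota.
Implicit Types (s t : G).
Local Notation U := (unit_box iota).

Definition real_coord (i : 'I_k) s : R := (iota s).1.1 0 i.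
Definition int_coord (j : 'I_m) s : int := ((iota s).1.2 : 'rV[int]_m) 0 j.

Let iotaD s t : iota (s + t) = iota s + iota t. Proof. by case: iota_iso. Qed.
Let ciota : continuous iota. Proof. by case: iota_iso. Qed.

Lemma real_coordD i s t : real_coord i (s + t) = real_coord i s + real_coord i t.
Proof. by rewrite /real_coord iotaD /= mxE. Qed.

Lemma int_coordD j s t : int_coord j (s + t) = int_coord j s + int_coord j t.
Proof. by rewrite /int_coord iotaD /= mxE. Qed.

Lemma continuous_real_coord i : continuous (real_coord i).
Proof.
move=> s; apply: (@continuous_comp _ _ _ (fun s => (iota s).1.1) (fun x : 'rV[R]_k => x 0 i)).
  apply: (@continuous_comp _ _ _ (fun s => (iota s).1) fst).
    by apply: (@continuous_comp _ _ _ iota fst); [exact: ciota|exact: cvg_fst].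
  exact: cvg_fst.
exact: coord_continuous.
Qed.

Lemma near_int_part s : \forall t \near s, (iota t).1.2 = (iota s).1.2.
Proof.
have c : {for s, continuous (fun s => (iota s).1.2)}.
  apply: (@continuous_comp _ _ _ (fun s => (iota s).1) snd).
    by apply: (@continuous_comp _ _ _ iota fst); [exact: ciota|exact: cvg_fst].
  exact: cvg_snd.
apply: (c [set x | x = (iota s).1.2]).
by apply: open_nbhs_nbhs; split => //; exact: discrete_open.
Qed.

Lemma continuous_int_coord j : continuous (fun s => (int_coord j s)%:~R : R).
Proof.
move=> s; apply: (@cvg_near_cst _ _ _ _ (nbhs s)).
by apply: filterS (near_int_part s) => t st; rewrite /int_coord st.
Qed.

Lemma open_unit_box : open U.
Proof.
rewrite openE => s [s1 s2].
have near1 : \forall t \near s, forall i, `|real_coord i t| < 1.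
  apply: filter_forall => i.
  have : open [set t | `|real_coord i t| < 1].
    rewrite (_ : [set _ | _] = real_coord i @^-1` ball (0 : R) 1).
      by apply: open_comp => [t _|]; [exact: continuous_real_coord|exact: ball_open].
    by apply/seteqP; split=> t; rewrite /ball/= sub0r normrN.
  by move=> o; apply: open_nbhs_nbhs; split => //; exact: s1.
near=> t; split.
  by near: t.
have -> : (iota t).1.2 = (iota s).1.2 by near: t; exact: near_int_part.
exact: s2.
Unshelve. all: by end_near.
Qed.

Let iota0 : iota 0 = 0.
Proof. by apply: (addrI (iota 0)); rewrite -iotaD !addr0. Qed.

Lemma unit_box0 : U 0.
Proof. by split=> i; rewrite iota0 mxE ?normr0. Qed.

Lemma unit_box_opp s : U s -> U (- s).
Proof.
have iotaN : iota (- s) = - iota s.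
  by apply: (addrI (iota s)); rewrite -iotaD !subrr iota0.
move=> [s1 s2]; split=> i; rewrite iotaN /= mxE ?normrN//.
by move: (s2 i); rewrite !inE => /or3P[] /eqP ->.
Qed.

(** Split [s] into its three components: a real vector is a multiple of a short one,
an integral vector is a combination of unit vectors, and the compact component
already lies in the unit box. *)
Lemma unit_box_generates s : exists n, sumset U n s.
Proof.
have [_ _ [j [iotaK jK] _]] := iota_iso.
have jD x y : j (x + y) = j x + j y.
  by rewrite -{1}[x]jK -{1}[y]jK -iotaD iotaK.
have j0 : j 0 = 0 by apply: (addrI (j 0)); rewrite -jD !addr0.
pose H s := exists n, sumset U n s.
have HD s1 s2 : H s1 -> H s2 -> H (s1 + s2).
  by move=> [n1 h1] [n2 h2]; exists (n1 + n2)%N; exact: sumsetD.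
have H0 : H 0 by exists 0%N; exact/sumset0.
have HU s1 : U s1 -> H s1 by move=> h; exists 1%N; exact: sumset1.
have HM s1 n : H s1 -> H (s1 *+ n).
  by move=> h; elim: n => [//|n ih]; rewrite mulrS; exact: HD.
have HN s1 : H s1 -> H (- s1).
  move=> [n [u Uu ->]]; exists n, (fun i => - u i); last by rewrite sumrN.
  by move=> i; exact: unit_box_opp.
rewrite -[s]iotaK; case: (iota s) => [[x z] t].
have -> : (x, z, t) = (x, 0, 0) + (0, z, 0) + (0, 0, t).
  by congr (_, _, _); rewrite /= ?addr0 ?add0r.
rewrite !jD; apply: (HD); first apply: (HD).
- pose n := (Num.bound (\sum_i `|x 0 i|)).+1.
  have xn i : `|x 0 i| < n%:R.
    apply: (@le_lt_trans _ _ (\sum_i `|x 0 i|)).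
      by rewrite (bigD1 i)//= lerDl sumr_ge0.
    apply: lt_le_trans (archi_boundP (sumr_ge0 _ (fun _ _ => normr_ge0 _))) _.
    by rewrite ler_nat.
  have n0 : 0 < n%:R :> R by rewrite ltr0n.
  have -> : j (x, 0, 0) = j (n%:R^-1 *: x, 0, 0) *+ n.
    have E q : j (n%:R^-1 *: x, 0, 0) *+ q = j ((q%:R * n%:R^-1) *: x, 0, 0).
      elim: q => [|q ih]; first by rewrite mul0r scale0r mulr0n j0.
      rewrite mulrSr ih -jD; congr j; congr (_, _, _); rewrite /= ?addr0//.
      by rewrite -scalerDl -natr1 mulrDl mul1r.
    by rewrite E mulfV ?gt_eqF// scale1r.
  apply: HM; apply: HU; split=> i; rewrite jK /= mxE//.
  by rewrite normrM normfV [X in X^-1]gtr0_norm// mulrC ltr_pdivrMr// mul1r.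
- have dU i : H (j (0, delta_mx 0 i, 0)).
    apply: HU; split=> l; rewrite jK /= mxE ?normr0//.
    by rewrite !inE; case: (_ && _).
  have jN y : j (0, - y, 0) = - j (0, y, 0).
    apply: (addrI (j (0, y, 0))); rewrite -jD subrr -j0; congr j.
    by congr (_, _, _); rewrite /= ?addr0 ?subrr.
  have jz y y' : j (0, y + y', 0) = j (0, y, 0) + j (0, y', 0).
    by rewrite -jD; congr j; congr (_, _, _); rewrite /= ?addr0.
  pose Q (y : 'rV[int]_m) := H (j (0, y, 0)).
  have Q0 : Q 0 by rewrite /Q (_ : j _ = 0).
  have QD y y' : Q y -> Q y' -> Q (y + y') by rewrite /Q jz; exact: HD.
  have QN y : Q y -> Q (- y) by rewrite /Q jN; exact: HN.
  have QM y (n : nat) : Q y -> Q (y *+ n).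
    by move=> h; elim: n => [//|n ih]; rewrite mulrS; exact: QD.
  have QZ y (c : int) : Q y -> Q (c *: y).
    move=> h; rewrite -[c]intz scaler_int; case: c => n; first exact: QM.
    by rewrite NegzE mulrNz; apply: QN; exact: QM.
  change (Q z); rewrite (row_sum_delta z).
  by apply: (big_ind Q) => // i _; apply: QZ; exact: dU.
- by apply: HU; split=> i; rewrite jK /= mxE ?normr0.
Qed.

Lemma real_coord_le1 i s : U s -> `|real_coord i s| <= 1.
Proof. by move=> [s1 _]; exact: ltW (s1 i). Qed.

Lemma int_coord_le1 j s : U s -> `|(int_coord j s)%:~R : R| <= 1.
Proof.
move=> [_ s2]; have := s2 j; rewrite -/(int_coord j s) !inE => /or3P[] /eqP ->.
- by rewrite normrN normr1.
- by rewrite normr0.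
- by rewrite normr1.
Qed.

Lemma real_coord_gt0 i : exists2 e, U e & 0 < real_coord i e.
Proof.
have [_ _ [j [iotaK jK] _]] := iota_iso.
have h2 : 0 < 2^-1 :> R by rewrite invr_gt0.
exists (j (2^-1 *: delta_mx 0 i, 0, 0)).
  split=> l; rewrite jK /= !mxE//.
  rewrite eqxx /=; case: eqP => _; last by rewrite mulr0 normr0.
  by rewrite mulr1 gtr0_norm// invf_lt1// ltr1n.
by rewrite /real_coord jK /= !mxE !eqxx mulr1.
Qed.

Lemma int_coord_gt0 i : exists2 e, U e & 0 < (int_coord i e)%:~R :> R.
Proof.
have [_ _ [j [iotaK jK] _]] := iota_iso.
exists (j (0, delta_mx 0 i, 0)).
  split=> l; rewrite jK /= mxE ?normr0//.
  by rewrite !inE; case: (_ && _).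
by rewrite /int_coord jK /= mxE !eqxx.
Qed.

Lemma compact_of_trivial_rank : k = 0%N -> m = 0%N -> compact [set: T] ->
  compact [set: G].
Proof.
move=> k0 m0 cT; have [_ _ [j [iotaK jK] cj]] := iota_iso.
pose f (t : T) : 'rV[R]_k * discrete_topology 'rV[int]_m * T := (0, 0, t).
have cf : continuous f.
  move=> t; have c0 : (fun _ : T => (f t).1) @ t --> (f t).1 by exact: cvg_cst.
  exact: (cvg_pair c0 cvg_id).
have -> : [set: G] = (j \o f) @` [set: T].
  apply/seteqP; split=> [s _|//]; exists (iota s).2 => //.
  rewrite -[RHS]iotaK /f /=; congr j; case: (iota s) => [[x z] t] /=.
  congr (_, _, _); apply/rowP => i.
    by have := leq_trans (ltn_ord i) (eq_leq k0).
  by have := leq_trans (ltn_ord i) (eq_leq m0).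
apply: continuous_compact => //; apply: continuous_subspaceT => t.
exact: (continuous_comp (cf t) (cj (f t))).
Qed.

End UnitBox.

Theorem theorem3p4 (R : realType) (G : topologicalZmodType)
    (mu : {measure set (borel G) -> \bar R})
    (k m : nat) (T : topologicalZmodType)
    (iota : G -> 'rV[R]_k * discrete_topology 'rV[int]_m * T)
    (Phi Psi : R -> \bar R) (nu : nat -> R) (omega : G -> R) :
  hausdorff_space G ->
  locally_compact [set: G] ->
  compactly_generated G ->
  ~ compact [set: G] ->
  haar_measure mu ->
  compact [set: T] ->
  topological_group_iso iota ->
  complementary_pair Phi Psi ->
  continuous_increasing Phi ->
  continuous_increasing Psi ->
  (forall n, 0 <= nu n) ->
  (forall p q, (p <= q)%N -> nu p <= nu q) ->
  (forall p q, nu (p + q)%N <= nu p + nu q) ->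
  nu 0%N = 0 ->
  nu n @[n --> \oo] --> +oo ->
  (forall t, omega t = expR (nu (word_length (unit_box iota) t))) ->
  banach_algebra (weighted_space omega (orlicz_space mu Phi))
    (convolution mu) (weighted_norm mu Phi omega) ->
  orlicz_space mu Psi (fun t => ((omega t)^-1)%:C%C) ->
  young_function (fun x => Phi (Num.sqrt x)) ->
  ~ weakly_amenable (weighted_space omega (orlicz_space mu Phi))
      (convolution mu) (weighted_norm mu Phi omega) /\
  ~ weakly_amenable (weighted_space omega (orlicz_step_space mu Phi))
      (convolution mu) (weighted_norm mu Phi omega).
Proof.
move=> hG lcG _ ncG hmu cT iso pair ciPhi ciPsi _ nu_mono nu_subadd nu0 _ omegaE
  BA omega_inv ysqrt.
have main := weighted_orlicz_not_weakly_amenable hG lcG hmu (open_unit_box iso)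
  (unit_box0 iso) (unit_box_generates iso) (@unit_box_opp _ _ _ _ _ _ iso)
  pair ciPhi ciPsi ysqrt nu_mono nu_subadd nu0 omegaE omega_inv BA.
have [k0|k_gt0] := posnP k.
  have [m0|m_gt0] := posnP m.
    by case: ncG; exact: compact_of_trivial_rank iso k0 m0 cT.
  pose j := Ordinal m_gt0; have [e Ue e0] := int_coord_gt0 iso j.
  apply: (main (fun s => (int_coord iota j s)%:~R) e) => //.
  - exact: continuous_int_coord.
  - by move=> s t; rewrite (int_coordD iso) intrD.
  - by move=> s; exact: int_coord_le1.
pose i := Ordinal k_gt0; have [e Ue e0] := real_coord_gt0 iso i.
apply: (main (real_coord iota i) e) => //.
- exact: continuous_real_coord.
- by move=> s t; rewrite (real_coordD iso).
- by move=> s; exact: real_coord_le1.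
Qed.
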